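(* Let $m,R>0$ and $I_\infty=mR^2$. On $\Gamma=\mathbb{R}_{>0}\times\mathfrak{so}_3$ with its Hessian metric $g=D^2z$ (see context), put $u=2\beta^{-1/2}$ and let $\omega_1,\omega_2,\omega_3$ be the components of $\omega$ in an orthonormal basis of $\mathfrak{so}_3$. Then the totally covariant Riemannian curvature tensor $\mathrm{Riem}$ of $g$ satisfies, as $\beta\omega^2\to\infty$, $$\begin{aligned}\mathrm{Riem}=\beta^2\Big[&-\tfrac1{12}I_\infty^2\sum_{i,j}\big(d\omega_i\otimes d\omega_j\otimes d\omega_i\otimes d\omega_j-d\omega_j\otimes d\omega_i\otimes d\omega_i\otimes d\omega_j\big)\\&+\tfrac14I_\infty\sum_i\big(d\omega_i\otimes du\otimes du\otimes d\omega_i-du\otimes d\omega_i\otimes du\otimes d\omega_i\\&\qquad\qquad+du\otimes d\omega_i\otimes d\omega_i\otimes du-d\omega_i\otimes du\otimes d\omega_i\otimes du\big)\Big]+o(1).\end{aligned}$$ In particular $$\mathrm{Riem}=-\tfrac1{12}\,G+o(1)\qquad(\beta\omega^2\to\infty),$$ where $G$ is one half of the Kulkarni–Nomizu product of $g$ with itself, i.e. the tensor with components $G_{abcd}=g_{ac}g_{bd}-g_{ad}g_{bc}$.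
   Context: Setting: $\mathfrak{so}_3$ is the Lie algebra of skew-symmetric real $3\times3$ matrices with inner product $\langle A,B\rangle=-\tfrac12\operatorname{tr}(AB)$, $\omega^2:=\langle\omega,\omega\rangle$. $\Gamma=\mathbb{R}_{>0}\times\mathfrak{so}_3$ has global coordinates $(\beta,\omega)$; put $r=-\beta\omega$. $D$ is the flat torsion-free affine connection on $\Gamma$ for which the coordinates $(\beta,r)$ are affine (vanishing connection coefficients). The potential is $z=\ln Z$, $$Z(\beta,\omega)=\int_{B(0,R)\times\mathbb{R}^3}e^{-\beta m\left(\frac12|v-\omega\cdot q|^2-\frac12|\omega\cdot q|^2\right)}m^3\,|\mathrm{d}^3q|\,|\mathrm{d}^3v|,$$ where $B(0,R)\subset\mathbb{R}^3$ is the open ball of radius $R$; the metric is $g=D^2z$ (the Hessian of $z$ in the coordinates $(\beta,r)$). For a covariant tensor field $\sigma$ on $\Gamma$, ''$\sigma=o(1)$ as $\beta\omega^2\to\infty$'' means that $\|\sigma\|\to0$ as $\beta\omega^2\to\infty$ (uniformly in all other variables), the norm being the one induced by $g$. Conventions: one half of the Kulkarni–Nomizu product of $g$ with itself has components $g_{ac}g_{bd}-g_{ad}g_{bc}$, and the sign and index conventions of $\mathrm{Riem}_{abcd}$ are such that a metric of constant sectional curvature $\kappa$ has $\mathrm{Riem}_{abcd}=\kappa(g_{ac}g_{bd}-g_{ad}g_{bc})$. *)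

(* Defs.v *)
From HB Require Import structures.
From mathcomp Require Import all_boot all_order all_algebra.
From mathcomp Require Import all_classical all_reals all_analysis.

Set Implicit Arguments.
Unset Strict Implicit.
Unset Printing Implicit Defensive.

Import Order.TTheory GRing.Theory Num.Theory.
Import numFieldNormedType.Exports.

Local Open Scope classical_set_scope.
Local Open Scope ring_scope.

(** * Riemannian geometry in one global chart

    Points of the chart are row vectors of size [n.+1]; a covariant tensor field
    is given by its components in the coordinate frame. *)

Section RiemannianChart.
Context {R : realType} {n : nat}.

Definition covector_field := 'rV[R]_n.+1 -> 'I_n.+1 -> R.
Definition tensor4_field :=
  'rV[R]_n.+1 -> 'I_n.+1 -> 'I_n.+1 -> 'I_n.+1 -> 'I_n.+1 -> R.

Implicit Types (f : 'rV[R]_n.+1 -> R) (x : 'rV[R]_n.+1).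
Implicit Types (g : 'rV[R]_n.+1 -> 'M[R]_n.+1) (a b c d k l : 'I_n.+1).

Definition partial a f x : R := 'D_(delta_mx 0 a) f x.

Definition differential f : covector_field := fun x a => partial a f x.

Definition hessian f x : 'M[R]_n.+1 :=
  \matrix_(a, b) partial a (partial b f) x.

(* [christoffel g k a b x] is Gamma^k_{ab} of the Levi-Civita connection. *)
Definition christoffel g k a b x : R :=
  2^-1 * \sum_l invmx (g x) k l *
    (partial a (fun y => g y b l) x + partial b (fun y => g y a l) x
     - partial l (fun y => g y a b) x).

(* R^k_{bcd}, the k-th component of R(d_c, d_d) d_b, where
   R(X, Y) = [nabla_X, nabla_Y] - nabla_[X, Y]. *)
Definition riemann_up g x k b c d : R :=
  partial c (christoffel g k d b) x - partial d (christoffel g k c b) x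
  + \sum_l (christoffel g k c l x * christoffel g l d b x
            - christoffel g k d l x * christoffel g l c b x).

(* With this sign, constant curvature kappa means
   riemann g x a b c d = kappa * (g_ac g_bd - g_ad g_bc). *)
Definition riemann g : tensor4_field := fun x a b c d =>
  \sum_k g x a k * riemann_up g x k b c d.

Definition half_kulkarni_nomizu g : tensor4_field := fun x a b c d =>
  g x a c * g x b d - g x a d * g x b c.

Definition tensor_prod4 (s1 s2 s3 s4 : covector_field) : tensor4_field :=
  fun x a b c d => s1 x a * s2 x b * s3 x c * s4 x d.

Definition tensor4_norm g (s : tensor4_field) x : R :=
  Num.sqrt (\sum_a \sum_b \sum_c \sum_d \sum_a' \sum_b' \sum_c' \sum_d'
    invmx (g x) a a' * invmx (g x) b b' * invmx (g x) c c' * invmx (g x) d d'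
    * s x a b c d * s x a' b' c' d').

End RiemannianChart.

(* The library proves this, but its instance is shadowed by the one for
   subprobabilities, so that products of sigma-finite measures cannot be nested
   on the right without the instances declared below. *)
Lemma sigma_finite_product_measure1 d1 d2 (T1 : measurableType d1)
    (T2 : measurableType d2) (R : realType)
    (m1 : {sigma_finite_measure set T1 -> \bar R})
    (m2 : {sigma_finite_measure set T2 -> \bar R}) :
  sigma_finite setT (m1 \x m2)%E.
Proof.
have /sigma_finiteP[F [TF ndF Foo]] := sigma_finiteT m1.
have /sigma_finiteP[G [TG ndG Goo]] := sigma_finiteT m2.
exists (fun n => F n `*` G n).
 rewrite -setXTT TF TG predeqE => -[x y]; split.
    move=> [/= [n _ Fnx] [k _ Gky]]; exists (maxn n k) => //; split.
    - by move: x Fnx; exact/subsetPset/ndF/leq_maxl.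
    - by move: y Gky; exact/subsetPset/ndG/leq_maxr.
  by move=> [n _ []/= ? ?]; split; exists n.
move=> k; have [? ?] := Foo k; have [? ?] := Goo k.
split; first exact: measurableX.
by rewrite product_measure1E// lte_mul_pinfty// ge0_fin_numE.
Qed.

Section RotatingGas.
Context {R : realType}.

(** * The Lie algebra so_3 and the space Gamma *)

Definition so3_inner (A B : 'M[R]_3) : R := - 2^-1 * \tr (A *m B).

(* Three orthonormal elements of the 3-dimensional space of skew-symmetric
   matrices automatically form a basis. *)
Definition so3_orthonormal_basis (e : 'I_3 -> 'M[R]_3) : Prop :=
  (forall i, (e i)^T = - e i) /\
  (forall i j, so3_inner (e i) (e j) = (i == j)%:R).

(* A point of Gamma is described by its D-affine coordinates
   x = (beta, r_1, r_2, r_3), where r = - beta omega and the r_i are the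
   components of r in an orthonormal basis e of so_3. The chart identifies Gamma
   with the half-space [0 < beta_of x]. *)
Definition beta_of (x : 'rV[R]_4) : R := x 0 ord0.

Definition omega_coord (i : 'I_3) (x : 'rV[R]_4) : R :=
  - x 0 (lift ord0 i) / beta_of x.

Definition omega_of (e : 'I_3 -> 'M[R]_3) (x : 'rV[R]_4) : 'M[R]_3 :=
  \sum_i omega_coord i x *: e i.

Definition u_of (x : 'rV[R]_4) : R := 2 * beta_of x `^ (- 2^-1).

(** * The partition function and the Hessian metric *)

Local Notation space1 := (measurableTypeR R).
Local Notation space2 := (space1 * space1)%type.
Local Notation space3 := (space1 * space1 * space1)%type.
Local Notation mu := (@lebesgue_measure R).

Definition lebesgue2 : set space2 -> \bar R := (mu \x mu)%E.
HB.instance Definition _ := Measure.on lebesgue2.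
HB.instance Definition _ := Measure_isSigmaFinite.Build _ _ _ lebesgue2
  (sigma_finite_product_measure1 mu mu).

Definition lebesgue3 : set space3 -> \bar R := (lebesgue2 \x mu)%E.
HB.instance Definition _ := Measure.on lebesgue3.
HB.instance Definition _ := Measure_isSigmaFinite.Build _ _ _ lebesgue3
  (sigma_finite_product_measure1 lebesgue2 mu).

Definition vec3 (q : space3) : 'cV[R]_3 :=
  \col_(i < 3) [:: q.1.1; q.1.2; q.2]`_i.

(* The Euclidean norm: the library's norm on matrices is the sup norm. *)
Definition sqnorm (v : 'cV[R]_3) : R := \sum_i v i 0 ^+ 2.

(* B(0, rad) x R^3, the first factor being position and the second velocity. *)
Definition phase_space (rad : R) : set (space3 * space3) :=
  [set p | sqnorm (vec3 p.1) < rad ^+ 2].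

Definition partition_function (m rad beta : R) (omega : 'M[R]_3) : R :=
  \int[(lebesgue3 \x lebesgue3)%E]_(p in phase_space rad)
    (expR (- beta * m * (2^-1 * sqnorm (vec3 p.2 - omega *m vec3 p.1)
                         - 2^-1 * sqnorm (omega *m vec3 p.1))) * m ^+ 3).

Definition potential (m rad : R) (e : 'I_3 -> 'M[R]_3) (x : 'rV[R]_4) : R :=
  ln (partition_function m rad (beta_of x) (omega_of e x)).

Definition gas_metric (m rad : R) (e : 'I_3 -> 'M[R]_3) : 'rV[R]_4 -> 'M[R]_4 :=
  hessian (potential m rad e).

(** * Asymptotics *)

(* sigma = o(1) as beta omega^2 -> +oo, uniformly in all other variables. *)
Definition small_o1 (m rad : R) (e : 'I_3 -> 'M[R]_3)
    (s : @tensor4_field R 3) : Prop :=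
  forall eps : R, 0 < eps ->
  exists M : R, forall x : 'rV[R]_4, 0 < beta_of x ->
    M < beta_of x * so3_inner (omega_of e x) (omega_of e x) ->
    tensor4_norm (gas_metric m rad e) s x < eps.

Definition leading_riemann (I : R) : @tensor4_field R 3 := fun x a b c d =>
  let du := differential u_of in
  let dw i := differential (omega_coord i) in
  beta_of x ^+ 2 *
  (- 12^-1 * I ^+ 2 * (\sum_(i < 3) \sum_(j < 3)
      (tensor_prod4 (dw i) (dw j) (dw i) (dw j) x a b c d
       - tensor_prod4 (dw j) (dw i) (dw i) (dw j) x a b c d))
   + 4^-1 * I * (\sum_(i < 3)
      (tensor_prod4 (dw i) du du (dw i) x a b c d
       - tensor_prod4 du (dw i) du (dw i) x a b c d
       + tensor_prod4 du (dw i) (dw i) du x a b c d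
       - tensor_prod4 (dw i) du (dw i) du x a b c d))).

End RotatingGas.

(* Main.v *)
(** Integrating out the velocity and rotating the axis of omega to a coordinate
    axis gives, with s = beta omega^2 and a = m R^2 / 2,
      Z = C beta^(-3/2) s^(-3/2) e^(a s) gamma(a s),
    where gamma is the lower incomplete Gamma function of exponent 3/2. So
    z = const - 3/2 ln beta + phi(s), where phi(s) is a s - 3/2 ln s up to a
    constant and a term that decays exponentially.

    For a Hessian metric g with T = D^3 z, the fourth derivatives cancel in the
    curvature: Riem_abcd = - 1/4 g^pq (T_acp T_bdq - T_adp T_bcq). In the frame
    made of the radial field beta d/dbeta + r d/dr and of the rescaled fields
    (beta / m R^2)^(1/2) d/dr_i, with dual coframe theta_0, ..., theta_3, the
    components of g and T converge as s tends to infinity, uniformly in the other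
    variables, to constants, g tending to h = 3 theta_0^2 + sum_i theta_i^2. The
    formula for Riem, evaluated on these limits, gives - 1/12 times one half of the
    Kulkarni-Nomizu product of h with itself. The leading tensor of the theorem is
    the same expression for the metric 3 beta du^2 + m R^2 beta domega^2, which is
    exactly h. *)

Require Import Defs.
From mathcomp Require Import all_boot all_order all_algebra.
From mathcomp Require Import all_classical all_reals all_analysis.
From mathcomp Require Import measurable_realfun ring lra.

Import Order.TTheory GRing.Theory Num.Theory.
Import numFieldNormedType.Exports.
Local Open Scope ring_scope.

Set Implicit Arguments.
Unset Strict Implicit.
Unset Printing Implicit Defensive.

(** * The partition function *)

(** The frame limit exists because s = |r|^2 / beta is homogeneous of degree 1 in (beta, r): the
    Hessian of the growing term a s annihilates the radial field. Along that field only - 3/2 ln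
    beta - 3/2 ln s = - 3 ln |r| acts, whence the coefficient 3 and T_000 = - 6. On d/dr_i, d/dr_j
    the growing term gives (m R^2 / beta) delta_ij, whence the rescaling, and its Hessian has degree
    - 1, whence T_0ij = - delta_ij. All other components of T vanish in the limit, so for distinct
    i, j >= 1 one gets Riem_ijij = - 1/4 * 1/3 = - 1/12 and Riem_0i0i = - 1/4 (6/3 - 1) = - 1/4 = -
    1/12 h_00 h_ii.

    The obstacle is that the derivatives of phi grow with s, so no limit can be taken termwise. The
    growing part is split off algebraically beforehand: it multiplies a single quadratic form, of
    size 1 / s in the frame.

    The integral is evaluated with Tonelli and one-dimensional substitutions alone. Its constant
    factor stays implicit, since the Hessian of ln Z does not see it. *)

(** The pushforward measure, hidden behind the two properties by which it is used. *)
Lemma image_measure d1 d2 (T1 : measurableType d1) (T2 : measurableType d2)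
    (R : realType) (m : {measure set T1 -> \bar R}) (phi : T1 -> T2) :
  measurable_fun setT phi ->
  exists nu : {measure set T2 -> \bar R},
    (forall f : T2 -> \bar R, measurable_fun setT f -> (forall y, 0 <= f y)%E ->
       (\int[nu]_y f y = \int[m]_x f (phi x))%E)
    /\ (forall A, nu A = m (phi @^-1` A)%classic).
Proof.
move=> mphi.
unshelve eexists (pushforward m phi); first exact: mphi.
by split=> // f mf f0; rewrite ge0_integral_pushforward.
Qed.

(** * Affine substitution on the line *)

Section Lebesgue.
Context {R : realType}.
Local Notation mu := (@lebesgue_measure R).
Local Notation space1 := (measurableTypeR R).
Local Open Scope classical_set_scope.

Lemma measurable_affine (a b : R) :
  measurable_fun setT (fun x : space1 => a * x + b : space1).
Proof. by apply: measurable_funD => //; apply: measurable_funM. Qed.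

(** [|a|] times the pushforward of Lebesgue measure along x |-> a x + b agrees with Lebesgue measure
    on half-open intervals, hence everywhere. Negative [a] is allowed because the radial integral
    below is reversed by its substitution. *)
Lemma ge0_integral_affine (a b : R) (f : space1 -> \bar R) : a != 0 ->
  measurable_fun setT f -> (forall x, 0 <= f x)%E ->
  (\int[mu]_x f x = `|a|%:E * \int[mu]_x f (a * x + b)%R)%E.
Proof.
move=> a0 mf f0.
pose phi : space1 -> space1 := fun x => a * x + b.
have mphi : measurable_fun setT phi := measurable_affine a b.
have na0 : 0 <= `|a| by [].
pose k : {nonneg R} := NngNum na0.
have [nu [nuE nuA]] := image_measure mu mphi.
have uniq A : measurable A -> mu A = mscale k nu A.
  apply: lebesgue_measure_unique => X [[u v] _ <-] /=.
  rewrite /mscale /= nuA.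
  have [a_gt0|a_lt0] := ltP 0 a.
    have -> : phi @^-1` `]u, v] = `](u - b) / a, (v - b) / a].
      apply/seteqP; split => y /=; rewrite !in_itv /phi /=.
        by rewrite ltr_pdivrMr// ler_pdivlMr// ltrBlDr lerBrDr mulrC.
      by rewrite ltr_pdivrMr// ler_pdivlMr// ltrBlDr lerBrDr mulrC.
    rewrite lebesgue_measure_itv [X in (_ * X)%E]lebesgue_measure_itv /=.
    rewrite !lte_fin ltr_pM2r ?invr_gt0// ltrD2r.
    case: ifPn => _; last by rewrite mule0.
    rewrite -!EFinD -EFinM; congr EFin; rewrite gtr0_norm//; field.
    exact: a0.
  have {}a_lt0 : a < 0 by rewrite lt_neqAle a0.
  (* Dividing by a negative number moves the closed end of the interval to the left; its length is
     unaffected. *)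
  have -> : phi @^-1` `]u, v] = `[(v - b) / a, (u - b) / a[.
    apply/seteqP; split => y /=; rewrite !in_itv /phi /= andbC.
      by rewrite ltr_ndivlMr// ler_ndivrMr// ltrBlDr lerBrDr mulrC.
    by rewrite ltr_ndivlMr// ler_ndivrMr// ltrBlDr lerBrDr mulrC.
  rewrite lebesgue_measure_itv [X in (_ * X)%E]lebesgue_measure_itv /=.
  rewrite !lte_fin ltr_nM2r ?invr_lt0// ltrD2r.
  case: ifPn => _; last by rewrite mule0.
  rewrite -!EFinD -EFinM; congr EFin; rewrite ltr0_norm//; field.
  exact: a0.
have -> : (\int[mu]_x f x = \int[mscale k nu]_x f x)%E.
  by apply: eq_measure_integral => A mA _; exact: uniq.
by rewrite ge0_integral_mscale// nuE.
Qed.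

Lemma ge0_integral_translation (b : R) (f : space1 -> \bar R) :
  measurable_fun setT f -> (forall x, 0 <= f x)%E ->
  (\int[mu]_x f x = \int[mu]_x f (x + b)%R)%E.
Proof.
move=> mf f0; rewrite (@ge0_integral_affine 1 b)// normr1 mul1e.
by apply: eq_integral => x _; rewrite mul1r.
Qed.

End Lebesgue.

Ltac prove_measurable :=
  repeat match goal with
  | H : measurable_fun _ ?f |- measurable_fun _ ?f => exact: H
  | |- measurable_fun _ (fun x => x) => exact: measurable_id
  | |- measurable_fun _ fst => exact: measurable_fst
  | |- measurable_fun _ snd => exact: measurable_snd
  | |- measurable_fun _ (fun=> ?c) => exact: measurable_cst
  | |- measurable_fun _ (fun x => (_, _)) => apply: measurable_fun_pair
  | |- measurable_fun _ (fun x => _ + _) => apply: measurable_funD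
  | |- measurable_fun _ (fun x => _ * _) => apply: measurable_funM
  | |- measurable_fun _ (fun x => - _) => apply: measurable_funN
  | |- measurable_fun _ (fun x => _ ^+ _) => apply: measurable_funX
  | |- measurable_fun _ (fun x => expR _) =>
      apply: (measurableT_comp (@measurable_expR _))
  | |- measurable_fun _ (fun x => fst (@?h x)) =>
      apply: (measurableT_comp measurable_fst)
  | |- measurable_fun _ (fun x => snd (@?h x)) =>
      apply: (measurableT_comp measurable_snd)
  | |- measurable_fun _ (fun x => (EFin (@?h x))) => apply/measurable_EFinP
  | H : measurable_fun _ ?f |- measurable_fun _ (fun x => ?f (@?h x)) =>
      apply: (measurableT_comp H)
  end.

(** * Rotation invariance of Lebesgue measure *)

Section Rotations.
Context {R : realType}.
Local Notation mu := (@lebesgue_measure R).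
Local Notation space1 := (measurableTypeR R).
Local Notation space2 := (space1 * space1)%type.
Local Notation space3 := (space1 * space1 * space1)%type.
Local Open Scope classical_set_scope.

Lemma ge0_integral_shear1 (t : R) (f : space2 -> \bar R) :
  measurable_fun setT f -> (forall z, 0 <= f z)%E ->
  (\int[lebesgue2]_z f z = \int[lebesgue2]_z f ((z.1 + t * z.2)%R, z.2))%E.
Proof.
move=> mf f0; rewrite /lebesgue2 fubini_tonelli2// fubini_tonelli2//; last first.
  by prove_measurable.
apply: eq_integral => y _; rewrite /fubini_G /=.
rewrite (@ge0_integral_translation _ (t * y) (fun x => f (x, y)))//.
by prove_measurable.
Qed.

Lemma ge0_integral_shear2 (t : R) (f : space2 -> \bar R) :
  measurable_fun setT f -> (forall z, 0 <= f z)%E ->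
  (\int[lebesgue2]_z f z = \int[lebesgue2]_z f (z.1, (z.2 + t * z.1)%R))%E.
Proof.
move=> mf f0; rewrite /lebesgue2 fubini_tonelli1// fubini_tonelli1//; last first.
  by prove_measurable.
apply: eq_integral => x _; rewrite /fubini_F /=.
rewrite (@ge0_integral_translation _ (t * x) (fun y => f (x, y)))//.
by prove_measurable.
Qed.

(* A plane rotation is a product of three shears, each of which preserves the
   Lebesgue measure by Tonelli and translation invariance. *)
Lemma ge0_integral_rotation (c s : R) (f : space2 -> \bar R) :
  c ^+ 2 + s ^+ 2 = 1 -> s != 0 ->
  measurable_fun setT f -> (forall z, 0 <= f z)%E ->
  (\int[lebesgue2]_z f z =
   \int[lebesgue2]_z f ((c * z.1 - s * z.2)%R, (s * z.1 + c * z.2)%R))%E.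
Proof.
(* With c = cos theta and s = sin theta this is t = - tan (theta / 2), the slope of the two outer
   shears; the middle shear has slope s. *)
move=> cs1 s0 mf f0; pose t := (c - 1) / s.
rewrite (ge0_integral_shear1 t mf f0) (ge0_integral_shear2 s)//; last first.
  by prove_measurable.
rewrite (ge0_integral_shear1 t)//; last by prove_measurable.
apply: eq_integral => -[x y] _ /=; congr (f (_, _)); rewrite /t; last first.
  by field.
have -> : s * y = (1 - c ^+ 2) / s * y.
  by rewrite -cs1 addrAC subrr add0r expr2 mulfK.
by field.
Qed.

(** The rotation with cosine b / rho and sine - a / rho carries the linear form to rho times the
    second coordinate and preserves the radius. For a = 0 the form already has this shape with rho =
    b, of either sign, so only the square of rho is asserted. *)
Lemma ge0_integral_radial_linear2 (a b : R) :
  exists2 rho : R, rho ^+ 2 = a ^+ 2 + b ^+ 2 &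
  forall f : space2 -> \bar R,
    measurable_fun setT f -> (forall z, 0 <= f z)%E ->
    (\int[lebesgue2]_z f ((z.1 ^+ 2 + z.2 ^+ 2)%R, (a * z.1 + b * z.2)%R) =
     \int[lebesgue2]_z f ((z.1 ^+ 2 + z.2 ^+ 2)%R, (rho * z.2)%R))%E.
Proof.
have [->|a0] := eqVneq a 0.
  exists b => [|f mf f0]; first by rewrite expr0n add0r.
  by apply: eq_integral => z _; rewrite mul0r add0r.
have ab0 : 0 < a ^+ 2 + b ^+ 2 by rewrite ltr_pwDl ?sqr_ge0// exprn_even_gt0.
pose rho := Num.sqrt (a ^+ 2 + b ^+ 2).
have rhoE : rho ^+ 2 = a ^+ 2 + b ^+ 2 by rewrite sqr_sqrtr// ltW.
have rho0 : rho != 0 by rewrite gt_eqF// sqrtr_gt0.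
have r1 : (b / rho) ^+ 2 + (- a / rho) ^+ 2 = 1.
  rewrite !exprMn !exprVn -mulrDl rhoE sqrrN [b ^+ 2 + _]addrC divff// gt_eqF//.
exists rho => // f mf f0.
rewrite (@ge0_integral_rotation (b / rho) (- a / rho))//; last 2 first.
- by rewrite mulf_neq0 ?invr_eq0// oppr_eq0.
- by prove_measurable.
apply: eq_integral => -[x y] _ /=; congr (f (_, _)).
  have -> : x ^+ 2 + y ^+ 2 = (x ^+ 2 + y ^+ 2) * ((b / rho) ^+ 2 + (- a / rho) ^+ 2).
    by rewrite r1 mulr1.
  by field.
have -> : rho * y = rho ^+ 2 / rho * y by rewrite expr2 mulfK.
by rewrite rhoE; field.
Qed.

(** [lebesgue3] is nested to the left; this regrouping exposes the last two coordinates as a plane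
    to be rotated. *)
Lemma ge0_integral_lebesgue3 (f : space3 -> \bar R) :
  measurable_fun setT f -> (forall z, 0 <= f z)%E ->
  (\int[lebesgue3]_z f z = \int[mu]_x \int[lebesgue2]_z f (x, z.1, z.2))%E.
Proof.
move=> mf f0; rewrite /lebesgue3 fubini_tonelli1//.
rewrite /lebesgue2 fubini_tonelli1//=; last 2 first.
- exact: measurable_fun_fubini_tonelli_F.
- by move=> z; apply: integral_ge0.
apply: eq_integral => x _; rewrite /fubini_F fubini_tonelli1//.
by prove_measurable.
Qed.

(** Two plane rotations suffice: one merges the coefficients a and b into d on the second
    coordinate, the other merges d and c into rho on the third. *)
Lemma ge0_integral_radial_linear3 (a b c : R) :
  exists2 rho : R, rho ^+ 2 = a ^+ 2 + b ^+ 2 + c ^+ 2 &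
  forall f : space2 -> \bar R,
    measurable_fun setT f -> (forall z, 0 <= f z)%E ->
    (\int[lebesgue3]_q f ((q.1.1 ^+ 2 + q.1.2 ^+ 2 + q.2 ^+ 2)%R,
                          (a * q.1.1 + b * q.1.2 + c * q.2)%R) =
     \int[lebesgue3]_q f ((q.1.1 ^+ 2 + q.1.2 ^+ 2 + q.2 ^+ 2)%R,
                          (rho * q.2)%R))%E.
Proof.
have [d dE dI] := ge0_integral_radial_linear2 a b.
have [rho rhoE rhoI] := ge0_integral_radial_linear2 d c.
exists rho => [|f mf f0]; first by rewrite rhoE dE.
transitivity (\int[lebesgue3]_q f ((q.1.1 ^+ 2 + q.1.2 ^+ 2 + q.2 ^+ 2)%R,
                          (d * q.1.2 + c * q.2)%R))%E.
  rewrite /lebesgue3 fubini_tonelli2//; last by prove_measurable.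
  rewrite fubini_tonelli2//; last by prove_measurable.
  apply: eq_integral => z _; rewrite /fubini_G /=.
  apply: (dI (fun p => f ((p.1 + z ^+ 2)%R, (p.2 + c * z)%R))) => //.
  by prove_measurable.
rewrite ge0_integral_lebesgue3//; last by prove_measurable.
rewrite ge0_integral_lebesgue3//; last by prove_measurable.
apply: eq_integral => x _ /=.
have := rhoI (fun p => f ((x ^+ 2 + p.1)%R, p.2)); rewrite /=.
under eq_integral do rewrite addrA.
under [in RHS]eq_integral do rewrite addrA.
apply=> //.
by prove_measurable.
Qed.

End Rotations.

(** * Radial integrals in the plane *)

Section RadialIntegrals.
Context {R : realType}.
Local Notation mu := (@lebesgue_measure R).
Local Notation space1 := (measurableTypeR R).
Local Notation space2 := (space1 * space1)%type.
Local Notation space3 := (space1 * space1 * space1)%type.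
Local Open Scope classical_set_scope.

Let radius2 (z : space2) : space1 := z.1 ^+ 2 + z.2 ^+ 2.
Let disk (T : R) : set space2 := radius2 @^-1` `]-oo, T].

Let measurable_radius2 : measurable_fun setT radius2.
Proof. by rewrite /radius2; prove_measurable. Qed.

Let measurable_disk T : measurable (disk T).
Proof. by rewrite -[disk T]setTI; apply: measurable_radius2. Qed.

Lemma ge0_integral_dilation (a : R) (f : space2 -> \bar R) : 0 < a ->
  measurable_fun setT f -> (forall z, 0 <= f z)%E ->
  (\int[lebesgue2]_z f z =
   (a ^+ 2)%:E * \int[lebesgue2]_z f ((a * z.1)%R, (a * z.2)%R))%E.
Proof.
move=> a0 mf f0; have a_neq0 : a != 0 by rewrite gt_eqF.
rewrite /lebesgue2 fubini_tonelli1// fubini_tonelli1//; last by prove_measurable.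
rewrite (@ge0_integral_affine _ a 0)//; last 2 first.
- exact: measurable_fun_fubini_tonelli_F.
- by move=> x; apply: integral_ge0.
rewrite gtr0_norm// expr2 EFinM -muleA; congr (_ * _)%E.
rewrite -ge0_integralZl//; last 3 first.
- apply: (@measurable_fun_fubini_tonelli_F _ _ _ _ _ mu
    (fun z => f ((a * z.1)%R, (a * z.2)%R))) => //.
  by prove_measurable.
- by move=> x _; apply: integral_ge0.
- by rewrite lee_fin ltW.
apply: eq_integral => x _; rewrite /fubini_F /= addr0.
rewrite (@ge0_integral_affine _ a 0 (fun y => f (_, y)))//; last by prove_measurable.
rewrite gtr0_norm//; congr (_ * _)%E.
by apply: eq_integral => y _; rewrite addr0.
Qed.

Let measure_disk_scale T : 0 < T ->
  (lebesgue2 (disk T) = T%:E * lebesgue2 (disk 1))%E.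
Proof.
move=> T0.
have diskE S : lebesgue2 (disk S) = (\int[lebesgue2]_z (\1_(disk S) z)%:E)%E.
  by rewrite integral_indic ?setIT//; exact: measurable_disk.
rewrite !diskE (@ge0_integral_dilation (Num.sqrt T)) ?sqrtr_gt0//; last first.
  by apply/measurable_EFinP/measurable_indic; exact: measurable_disk.
rewrite sqr_sqrtr ?ltW//; congr (_ * _)%E.
apply: eq_integral => -[x y] _; rewrite !indicE /=; congr ((nat_of_bool _)%:R%:E).
have rE : radius2 (Num.sqrt T * x, Num.sqrt T * y) = T * radius2 (x, y).
  by rewrite /radius2 /= !exprMn sqr_sqrtr ?ltW// mulrDr.
by apply/idP/idP; rewrite !inE /disk /preimage /= !in_itv /= rE ger_pMr.
Qed.

Let measure_disk1_lty : (lebesgue2 (disk 1) < +oo)%E.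
Proof.
apply: (@le_lt_trans _ _ (lebesgue2 (`[-1, 1] `*` `[-1, 1]))).
  apply: le_measure; rewrite ?inE.
  - exact: measurable_disk.
  - exact: measurableX.
  move=> [x y]; rewrite /disk /radius2 /= !in_itv /= => xy1.
  by split; rewrite -ler_norml -ler_sqr ?nnegrE// expr1n real_normK
    ?num_real// (le_trans _ xy1)// ?lerDl ?lerDr sqr_ge0.
rewrite /lebesgue2 product_measure1E//= !lebesgue_measure_itv /=.
by case: ifP => _; rewrite -?EFinD -?EFinM ltry.
Qed.

Let measure_disk1_gt0 : (0 < lebesgue2 (disk 1))%E.
Proof.
apply: (@lt_le_trans _ _ (lebesgue2 (`[0, 2^-1] `*` `[0, 2^-1]))).
  rewrite /lebesgue2 product_measure1E//= !lebesgue_measure_itv /= lte_fin.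
  by rewrite invr_gt0 ltr0n -?EFinD -?EFinM lte_fin; lra.
apply: le_measure; rewrite ?inE.
- exact: measurableX.
- exact: measurable_disk.
move=> [x y] /= []; rewrite /disk /radius2 /= !in_itv /= => /andP[? ?] /andP[? ?].
by nra.
Qed.

Let area := fine (lebesgue2 (disk 1)).

Let area_gt0 : 0 < area.
Proof. by rewrite fine_gt0// measure_disk1_gt0 measure_disk1_lty. Qed.

Let measure_disk T : (lebesgue2 (disk T) = (area * Num.max T 0)%:E)%E.
Proof.
have [T0|T0] := ltP 0 T.
  rewrite measure_disk_scale// EFinM muleC fineK//.
  by rewrite ge0_fin_numE ?measure_disk1_lty.
rewrite mulr0; apply/eqP; rewrite -measure_le0.
apply: (@le_trans _ _ (lebesgue2 ([set 0] `*` [set 0]))).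
  apply: le_measure; rewrite ?inE.
  - exact: measurable_disk.
  - exact: measurableX.
  move=> [x y]; rewrite /disk /radius2 /= !in_itv /= => xy0.
  by split; apply/eqP; rewrite /= -sqrf_eq0; nra.
by rewrite /lebesgue2 product_measure1E//= lebesgue_measure_set1 mul0e.
Qed.

(** Polar coordinates without an angle: a disk of squared radius T > 0 has T times the area of the
    unit disk, by dilation, so the image of plane measure under the squared radius gives []u, v]]
    the mass [area * (max v 0 - max u 0)]. It is therefore [area] times Lebesgue measure on the
    half-line. *)
Lemma ge0_integral_radial2 : exists2 c : R, 0 < c &
  forall h : space1 -> \bar R, measurable_fun setT h -> (forall t, 0 <= h t)%E ->
  (\int[lebesgue2]_z h (z.1 ^+ 2 + z.2 ^+ 2)%R =
   c%:E * \int[mu]_(t in `[0%R, +oo[) h t)%E.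
Proof.
exists area => [|h mh h0]; first exact: area_gt0.
have [nu [nuE nuA]] := image_measure lebesgue2 measurable_radius2.
have na0 : 0 <= area by exact: ltW area_gt0.
pose k : {nonneg R} := NngNum na0.
have mD : measurable (`[0, +oo[ : set space1) by exact: measurable_itv.
pose m2 := mscale k (mrestr mu mD).
have m2E A : m2 A = (area%:E * mu (A `&` `[0%R, +oo[))%E by [].
have disk_lty T : (lebesgue2 (disk T) < +oo)%E by rewrite measure_disk ltry.
have nu_restr A : measurable A ->
    nu A = m2 A.
  move=> mA; refine (@measure_unique _ R space1 (@ocitv R)
    (fun n : nat => `]- n%:R, n%:R]) erefl (@ocitvI R)
    (fun n => is_ocitv _ _) (bigcup_itvT _ _) nu m2
    _ _ A mA).
  - move=> X [[u v] _ <-]; rewrite nuA; apply: etrans (esym (m2E _)).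
    have [vu|uv] := leP v u.
      by rewrite set_itv_ge ?bnd_simp -?leNgt// preimage_set0 set0I !measure0 mule0.
    have -> : radius2 @^-1` `]u, v] = disk v `\` disk u.
      apply/seteqP; split => z /=; rewrite !in_itv /=.
        by move=> /andP[? ?]; rewrite /disk /preimage /= !in_itv /=;
          split => //; apply/negP; rewrite -ltNge.
      by rewrite /disk /preimage /= !in_itv /= => -[-> /negP]; rewrite -ltNge => ->.
    rewrite measureD; [|exact: measurable_disk|exact: measurable_disk|exact: disk_lty].
    have -> : disk v `&` disk u = disk u.
      apply/setIidPr => z; rewrite /disk /= !in_itv /= => zu.
      by rewrite (le_trans zu)// ltW.
    transitivity ((area * Num.max v 0)%:E - (area * Num.max u 0)%:E)%E.
      by congr (_ - _)%E; exact: measure_disk.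
    have -> : `]u, v] `&` `[0, +oo[ = if u < 0 then `[0, v] else `]u, v].
      apply/seteqP; split => z /=; case: ifPn => u0 /=; rewrite !in_itv /= ?andbT.
      + by move=> [/andP[_ ->] ->].
      + by move=> [-> _].
      + by move=> /andP[z0 ->]; rewrite z0 (lt_le_trans u0 z0).
      + move=> /andP[uz zv]; rewrite uz zv (le_trans _ (ltW uz))// leNgt//.
    case: ifPn => u0.
      rewrite lebesgue_measure_itv /= lte_fin [Num.max u 0]max_r ?ltW// mulr0 sube0.
      case: ltP => v0; first by rewrite sube0 -EFinM.
      by rewrite mulr0 mule0.
    rewrite -leNgt in u0.
    rewrite lebesgue_measure_itv /= lte_fin uv !max_l//; last first.
      by rewrite (le_trans u0)// ltW.
    by rewrite -!EFinD -EFinM mulrBr.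
  - move=> n; rewrite nuA.
    apply: (@le_lt_trans _ _ (lebesgue2 (disk n%:R))).
      apply: le_measure; rewrite ?inE.
      - by rewrite -[X in measurable X]setTI; apply: measurable_radius2.
      - exact: measurable_disk.
      by move=> z; rewrite /disk /= !in_itv /= => /andP[].
    by rewrite measure_disk ltry.
transitivity (\int[lebesgue2]_z (h \_ `[0%R, +oo[) (radius2 z))%E.
  apply: eq_integral => z _; rewrite patchE mem_set// /= in_itv /= andbT.
  by rewrite addr_ge0// sqr_ge0.
rewrite -nuE; last 2 first.
- exact/(measurable_restrictT _ _).1/measurable_funTS.
- by move=> t; rewrite erestrict_ge0.
rewrite -integral_mkcond.
rewrite -[RHS](@ge0_integral_mscale _ _ _ mu _ mD k)//; last first.
  exact: measurable_funTS.
apply: eq_measure_integral => A mA AD.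
by rewrite nu_restr// m2E setIidl.
Qed.

End RadialIntegrals.

Lemma integral_indic_mul d (T : measurableType d) (R : realType)
    (mu : {measure set T -> \bar R}) (D : set T) (f : T -> R) :
  (\int[mu]_(t in D) (f t)%:E = \int[mu]_t (\1_D t * f t)%:E)%E.
Proof.
rewrite integral_mkcond; apply: eq_integral => t _; rewrite patchE indicE.
by case: ifPn => _; rewrite ?mul1r ?mul0r.
Qed.

(** * The integral over the ball and the incomplete Gamma function *)

Section BallIntegral.
Context {R : realType}.
Local Notation mu := (@lebesgue_measure R).
Local Notation space1 := (measurableTypeR R).
Local Notation space2 := (space1 * space1)%type.
Local Notation space3 := (space1 * space1 * space1)%type.
Local Open Scope classical_set_scope.

Lemma continuous_sqrt_expRN : continuous (fun y : R => Num.sqrt y * expR (- y)).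
Proof.
move=> y; apply: cvgM; first exact: sqrt_continuous.
apply: (@continuous_comp _ _ _ (fun z : R => - z) expR).
  exact: opp_continuous.
exact: continuous_expR.
Qed.

Lemma integrable_sqrt_expRN (x : R) :
  mu.-integrable `[0, x] (EFin \o (fun y : R => Num.sqrt y * expR (- y))).
Proof.
apply: continuous_compact_integrable; first exact: segment_compact.
by apply: continuous_subspaceT; exact: continuous_sqrt_expRN.
Qed.

Definition lower_gamma (x : R) : R :=
  \int[mu]_(y in `[0, x]) (Num.sqrt y * expR (- y)).

Lemma lower_gammaE x : (lower_gamma x)%:E =
  (\int[mu]_y (\1_(`[0%R, x]) y * (Num.sqrt y * expR (- y)))%:E)%E.
Proof.
rewrite -integral_indic_mul /lower_gamma /Rintegral fineK//.
by apply: integrable_fin_num => //; exact: integrable_sqrt_expRN.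
Qed.

(** For a <= t both sides are 0: the square root of a nonpositive number is 0, so the interval on
    the right is empty. *)
Lemma indic_sqr_lt (a t z : R) :
  \1_(`]-oo, a[) (t + z ^+ 2) =
  \1_(`]- Num.sqrt (a - t), Num.sqrt (a - t)[) z :> R.
Proof.
rewrite !indicE; congr ((nat_of_bool _)%:R).
apply/idP/idP; rewrite !inE /= !in_itv /= -ltr_norml -ltrBrDl -sqrtr_sqr.
  move=> zat; rewrite ltr_sqrt//.
  by rewrite (le_lt_trans _ zat)// sqr_ge0.
have [at0|at0] := ltP 0 (a - t); first by rewrite ltr_sqrt.
by rewrite (ler0_sqrtr at0) ltNge sqrtr_ge0.
Qed.

(** Length of the chord that the ball of squared radius a cuts from a line parallel to the axis at
    squared distance t. *)
Lemma integral_sphere_section (a t : R) :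
  (\int[mu]_z (\1_(`]-oo, a[) (t + z ^+ 2))%:E = (2 * Num.sqrt (a - t))%:E)%E.
Proof.
under eq_integral do rewrite indic_sqr_lt.
rewrite integral_indic//= setIT lebesgue_measure_itv /= lte_fin.
case: ifPn => [_|]; first by rewrite -EFinD opprK mulr2n mulrDl mul1r.
rewrite -leNgt => s0; congr EFin.
by apply/eqP; rewrite eq_sym mulf_eq0 pnatr_eq0 /= eq_le sqrtr_ge0 andbT; lra.
Qed.

(** In cylindrical coordinates the exponential depends only on t, the squared distance to the third
    axis. The axial integral is a chord length 2 sqrt (rad^2 - t), and y = sigma (rad^2 - t) turns
    the remaining integral over t into [lower_gamma]. *)
Lemma ball_integral : exists2 c : R, 0 < c &
  forall sigma rad : R, 0 < sigma ->
  (\int[lebesgue3]_q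
     (\1_(`]-oo, rad ^+ 2[) (q.1.1 ^+ 2 + q.1.2 ^+ 2 + q.2 ^+ 2)%R *
      expR (sigma * (q.1.1 ^+ 2 + q.1.2 ^+ 2)))%:E =
   (c * (expR (sigma * rad ^+ 2) / (sigma * Num.sqrt sigma) *
      lower_gamma (sigma * rad ^+ 2)))%:E)%E.
Proof.
have [c c0 cI] := @ge0_integral_radial2 R.
exists (2 * c) => [|sigma rad sigma0]; first by rewrite mulr_gt0.
set a := rad ^+ 2; pose chi : space1 -> R := \1_(`]-oo, a[).
have mchi : measurable_fun setT chi by exact: measurable_indic.
have chi0 t : 0 <= chi t by rewrite /chi indicE.
pose D : set space1 := `[0, +oo[.
pose ind : space1 -> R := \1_D.
have mind : measurable_fun setT ind.
  by apply: measurable_indic; exact: measurable_itv.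
have ind0 t : 0 <= ind t by rewrite /ind indicE.
pose g (p : space2) : \bar R := (ind p.1 * (chi (p.1 + p.2 ^+ 2) * expR (sigma * p.1)))%:E.
have mg : measurable_fun setT g by rewrite /g; prove_measurable.
have g0 p : (0 <= g p)%E by rewrite lee_fin !mulr_ge0// expR_ge0.
rewrite /lebesgue3 fubini_tonelli2; last 2 first.
- by rewrite -/chi; prove_measurable.
- by move=> q; rewrite lee_fin mulr_ge0 ?expR_ge0.
transitivity (\int[mu]_z (c%:E * \int[mu]_t g (t, z)))%E.
  apply: eq_integral => z _; rewrite /fubini_G /= -/chi.
  rewrite (cI (fun t => (chi (t + z ^+ 2)%R * expR (sigma * t))%:E)); last 2 first.
  - by prove_measurable.
  - by move=> t; rewrite lee_fin mulr_ge0 ?expR_ge0.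
  by rewrite integral_indic_mul.
rewrite ge0_integralZl//; last 3 first.
- exact: (@measurable_fun_fubini_tonelli_G _ _ _ _ _ mu g).
- by move=> z _; apply: integral_ge0.
- by rewrite lee_fin ltW.
rewrite -(@fubini_tonelli _ _ _ _ _ mu mu g)//.
have inner t : (\int[mu]_z g (t, z) =
    (ind t * expR (sigma * t) * (2 * Num.sqrt (a - t)))%:E)%E.
  rewrite EFinM -integral_sphere_section -ge0_integralZl//; last 2 first.
  - by apply/measurable_EFinP; rewrite -/chi; prove_measurable.
  - by rewrite lee_fin mulr_ge0 ?expR_ge0.
  by apply: eq_integral => z _; rewrite /g /= -EFinM -/chi mulrAC mulrA.
under eq_integral do rewrite inner.
have s0 : sigma != 0 by rewrite gt_eqF.
have rs0 : Num.sqrt sigma != 0 by rewrite gt_eqF ?sqrtr_gt0.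
(* The substitution t = a - y / sigma: t = 0 becomes y = sigma a, and t = a becomes y = 0. *)
rewrite (@ge0_integral_affine _ (- sigma^-1) a); last 3 first.
- by rewrite oppr_eq0 invr_eq0.
- have msqrt : measurable_fun setT (@Num.sqrt R).
    by apply: continuous_measurable_fun; exact: sqrt_continuous.
  by prove_measurable.
- by move=> t; rewrite lee_fin !mulr_ge0 ?expR_ge0 ?sqrtr_ge0.
rewrite normrN normfV gtr0_norm//.
pose K := 2 * expR (sigma * a) / Num.sqrt sigma.
have integrandE (y : R) : ind (- sigma^-1 * y + a) * expR (sigma * (- sigma^-1 * y + a)) *
    (2 * Num.sqrt (a - (- sigma^-1 * y + a))) =
    K * (\1_(`[0%R, sigma * a]) y * (Num.sqrt y * expR (- y))).
  have -> : a - (- sigma^-1 * y + a) = sigma^-1 * y by ring.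
  (* Negative y means t beyond the sphere, where both square roots take their default value 0. *)
  have [y0|y0] := ltP y 0.
    by rewrite !ler0_sqrtr ?(ltW y0)// ?mulr0 ?mul0r ?mulr0// nmulr_lle0// invr_ge0 ltW.
  have -> : sigma * (- sigma^-1 * y + a) = sigma * a + - y by field.
  have -> : ind (- sigma^-1 * y + a) = \1_(`[0%R, sigma * a]) y.
    rewrite /ind !indicE; congr ((nat_of_bool _)%:R).
    apply/idP/idP; rewrite !inE /D /= !in_itv /= y0 ?andbT mulNr addrC subr_ge0;
      by rewrite ler_pdivrMl.
  rewrite sqrtrM ?invr_ge0 ?(ltW sigma0)// sqrtrV ?(ltW sigma0)// expRD /K.
  by field.
under eq_integral do rewrite integrandE EFinM.
rewrite ge0_integralZl; last 4 first.
- by [].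
- apply/measurable_EFinP; apply: measurable_funM; first exact: measurable_indic.
  by apply: continuous_measurable_fun; exact: continuous_sqrt_expRN.
- by move=> y _; rewrite lee_fin !mulr_ge0 ?expR_ge0 ?sqrtr_ge0// indicE.
- by rewrite lee_fin /K !mulr_ge0 ?invr_ge0 ?expR_ge0 ?sqrtr_ge0.
rewrite -lower_gammaE -!EFinM; congr EFin; rewrite /K; field.
by rewrite s0 rs0.
Qed.

End BallIntegral.

(** * Closed form of the partition function *)

Section PartitionFunction.
Context {R : realType}.
Local Notation mu := (@lebesgue_measure R).
Local Notation space1 := (measurableTypeR R).
Local Notation space2 := (space1 * space1)%type.
Local Notation space3 := (space1 * space1 * space1)%type.
Local Open Scope classical_set_scope.

Lemma integral_gaussian (k u : R) : 0 < k ->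
  (\int[mu]_x (expR (- k * (x - u) ^+ 2))%:E =
   (Num.sqrt pi / Num.sqrt k)%:E)%E.
Proof.
move=> k0; have rk0 : 0 < Num.sqrt k by rewrite sqrtr_gt0.
have := @integralT_gauss R.
rewrite (@ge0_integral_affine _ (Num.sqrt k) (- Num.sqrt k * u)); last 3 first.
- by rewrite gt_eqF.
- by apply/measurable_EFinP; exact: measurable_gauss_fun.
- by move=> x; rewrite lee_fin gauss_fun_ge0.
rewrite gtr0_norm// => H.
have -> : (\int[mu]_x (expR (- k * (x - u) ^+ 2))%:E =
    \int[mu]_x (gauss_fun (Num.sqrt k * x + - Num.sqrt k * u)%R)%:E)%E.
  apply: eq_integral => x _; rewrite /gauss_fun.
  have -> : Num.sqrt k * x + - Num.sqrt k * u = Num.sqrt k * (x - u) by ring.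
  by rewrite exprMn sqr_sqrtr ?ltW// mulNr.
rewrite EFinM muleC -H muleA -EFinM mulVf ?mul1e// gt_eqF//.
Qed.

(** The value is independent of the centre, so the velocity integral, centred at omega q, decouples
    from the position. *)
Lemma integral_gaussian3 (k u0 u1 u2 : R) : 0 < k ->
  (\int[lebesgue3]_v (expR (- k * (v.1.1 - u0) ^+ 2) *
     expR (- k * (v.1.2 - u1) ^+ 2) * expR (- k * (v.2 - u2) ^+ 2))%:E =
   ((Num.sqrt pi / Num.sqrt k) ^+ 3)%:E)%E.
Proof.
move=> k0; set J := _ / _.
have J0 : 0 <= J by rewrite mulr_ge0 ?invr_ge0 ?sqrtr_ge0.
rewrite /lebesgue3 fubini_tonelli1; last 2 first.
- by prove_measurable.
- by move=> v; rewrite lee_fin !mulr_ge0 ?expR_ge0.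
transitivity (\int[lebesgue2]_v (expR (- k * (v.1 - u0) ^+ 2) *
     expR (- k * (v.2 - u1) ^+ 2) * J)%:E)%E.
  apply: eq_integral => v _; rewrite /fubini_F /=.
  under eq_integral do rewrite EFinM.
  rewrite ge0_integralZl; last 4 first.
  - by [].
  - by prove_measurable.
  - by move=> x _; rewrite lee_fin expR_ge0.
  - by rewrite lee_fin mulr_ge0 ?expR_ge0.
  by rewrite integral_gaussian.
rewrite /lebesgue2 fubini_tonelli1; last 2 first.
- by prove_measurable.
- by move=> v; rewrite lee_fin !mulr_ge0 ?expR_ge0.
transitivity (\int[mu]_x (J ^+ 2 * expR (- k * (x - u0) ^+ 2))%:E)%E.
  apply: eq_integral => x _; rewrite /fubini_F /=.
  under eq_integral do rewrite mulrAC EFinM.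
  rewrite ge0_integralZl; last 4 first.
  - by [].
  - by prove_measurable.
  - by move=> y _; rewrite lee_fin expR_ge0.
  - by rewrite lee_fin mulr_ge0 ?expR_ge0.
  by rewrite integral_gaussian// -EFinM -/J mulrC mulrCA mulrC expr2.
under eq_integral do rewrite EFinM.
rewrite ge0_integralZl; last 4 first.
- by [].
- by prove_measurable.
- by move=> x _; rewrite lee_fin expR_ge0.
- by rewrite lee_fin exprn_ge0.
by rewrite integral_gaussian// -EFinM -exprSr.
Qed.

Lemma ord3_lift0 : (lift ord0 ord0 = 1 :> 'I_3) * (lift ord0 (lift ord0 ord0) = 2%:R :> 'I_3).
Proof. by split; apply/val_inj. Qed.

Lemma skew3_entries (A : 'M[R]_3) : A^T = - A ->
  ((A 0 0 = 0) * (A 1 1 = 0) * (A 2%:R 2%:R = 0)) *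
  ((A 1 0 = - A 0 1) * (A 2%:R 0 = - A 0 2%:R) * (A 2%:R 1 = - A 1 2%:R)).
Proof.
move=> AT.
have sk i j : A i j = - A j i.
  by have := congr1 (fun M : 'M[R]_3 => M j i) AT; rewrite !mxE.
have d i : A i i = 0.
  have := sk i i; move=> /eqP; rewrite -addr_eq0 -mulr2n mulrn_eq0 /=.
  by move=> /eqP.
by do !split.
Qed.

Lemma so3_inner_skew (A : 'M[R]_3) : A^T = - A ->
  so3_inner A A = A 0 1 ^+ 2 + A 0 2%:R ^+ 2 + A 1 2%:R ^+ 2.
Proof.
move=> /skew3_entries AE; rewrite /so3_inner /mxtrace.
rewrite !big_ord_recl !big_ord0 !mxE !big_ord_recl !big_ord0 !ord3_lift0 !AE.
by field.
Qed.

Lemma sqnorm_vec3 (q : space3) :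
  sqnorm (vec3 q) = q.1.1 ^+ 2 + q.1.2 ^+ 2 + q.2 ^+ 2.
Proof. by rewrite /sqnorm !big_ord_recl big_ord0 !mxE /= addr0 addrA. Qed.

Lemma sqnorm_sub_skew (A : 'M[R]_3) (q v : space3) : A^T = - A ->
  sqnorm (vec3 v - A *m vec3 q) =
  (v.1.1 - (A 0 1 * q.1.2 + A 0 2%:R * q.2)) ^+ 2 +
  (v.1.2 - (- A 0 1 * q.1.1 + A 1 2%:R * q.2)) ^+ 2 +
  (v.2 - (- A 0 2%:R * q.1.1 - A 1 2%:R * q.1.2)) ^+ 2.
Proof.
move=> /skew3_entries AE; rewrite /sqnorm.
rewrite !big_ord_recl !big_ord0 !mxE !big_ord_recl !big_ord0 !mxE !ord3_lift0 !AE /=.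
by ring.
Qed.

(** Lagrange's identity |w x q|^2 = |w|^2 |q|^2 - (w . q)^2, with (A_12, - A_02, A_01) the axis
    vector of A up to sign. *)
Lemma sqnorm_skew (A : 'M[R]_3) (q : space3) : A^T = - A ->
  sqnorm (A *m vec3 q) =
  so3_inner A A * (q.1.1 ^+ 2 + q.1.2 ^+ 2 + q.2 ^+ 2) -
  (A 1 2%:R * q.1.1 + - A 0 2%:R * q.1.2 + A 0 1 * q.2) ^+ 2.
Proof.
move=> AT; rewrite so3_inner_skew//; have AE := skew3_entries AT.
rewrite /sqnorm.
rewrite !big_ord_recl !big_ord0 !mxE !big_ord_recl !big_ord0 !mxE !ord3_lift0 !AE /=.
by ring.
Qed.

Lemma partition_functionE (m rad : R) : 0 < m -> exists2 C : R, 0 < C &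
  forall (beta : R) (omega : 'M[R]_3), 0 < beta -> omega^T = - omega ->
  0 < so3_inner omega omega ->
  let sigma := m / 2 * (beta * so3_inner omega omega) in
  partition_function m rad beta omega =
  C / (beta * Num.sqrt beta) *
  (expR (sigma * rad ^+ 2) / (sigma * Num.sqrt sigma) *
   lower_gamma (sigma * rad ^+ 2)).
Proof.
move=> m0; have [c c0 ballE] := @ball_integral R.
have m20 : 0 < m / 2 by rewrite divr_gt0.
exists (m ^+ 3 * (Num.sqrt pi / Num.sqrt (m / 2)) ^+ 3 * c).
  by rewrite !mulr_gt0 ?exprn_gt0 ?mulr_gt0 ?invr_gt0 ?sqrtr_gt0 ?pi_gt0.
move=> beta A beta0 AT W0 sigma.
pose k := m / 2 * beta; have k0 : 0 < k by rewrite mulr_gt0.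
set W := so3_inner A A in W0 *.
pose chi : space1 -> R := \1_(`]-oo, rad ^+ 2[).
have mchi : measurable_fun setT chi by exact: measurable_indic.
have chi0 t : 0 <= chi t by rewrite /chi indicE.
pose a := A 0 1; pose b := A 0 2%:R; pose d := A 1 2%:R.
pose lin (q : space3) : R := d * q.1.1 + - b * q.1.2 + a * q.2.
pose rad2 (q : space3) : R := q.1.1 ^+ 2 + q.1.2 ^+ 2 + q.2 ^+ 2.
(* The integrand as a function of position times a product of three Gaussians in the velocity. *)
pose G (p : space3 * space3) : R :=
  chi (rad2 p.1) * expR (k * (W * rad2 p.1 - lin p.1 ^+ 2)) * m ^+ 3 *
  (expR (- k * (p.2.1.1 - (a * p.1.1.2 + b * p.1.2)) ^+ 2) *
   expR (- k * (p.2.1.2 - (- a * p.1.1.1 + d * p.1.2)) ^+ 2) *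
   expR (- k * (p.2.2 - (- b * p.1.1.1 - d * p.1.1.2)) ^+ 2)).
pose J := Num.sqrt pi / Num.sqrt k.
have J0 : 0 <= J by rewrite mulr_ge0 ?invr_ge0 ?sqrtr_ge0.
have K0 q : 0 <= chi (rad2 q) * expR (k * (W * rad2 q - lin q ^+ 2)) * m ^+ 3.
  by apply: mulr_ge0; [exact: mulr_ge0 (chi0 _) (expR_ge0 _)|exact/exprn_ge0/ltW].
rewrite /partition_function /Rintegral integral_indic_mul.
transitivity (fine (\int[(lebesgue3 \x lebesgue3)%E]_p (G p)%:E)).
  congr fine; apply: eq_integral => p _; congr EFin.
  have -> : \1_(phase_space rad) p = chi (rad2 p.1).
    rewrite /chi !indicE; congr ((nat_of_bool _)%:R).
    by apply/idP/idP; rewrite !inE /phase_space /= in_itv /= sqnorm_vec3.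
  have -> : expR (- beta * m * (2^-1 * sqnorm (vec3 p.2 - A *m vec3 p.1)
                         - 2^-1 * sqnorm (A *m vec3 p.1))) =
    expR (k * (W * rad2 p.1 - lin p.1 ^+ 2)) *
    (expR (- k * (p.2.1.1 - (a * p.1.1.2 + b * p.1.2)) ^+ 2) *
     expR (- k * (p.2.1.2 - (- a * p.1.1.1 + d * p.1.2)) ^+ 2) *
     expR (- k * (p.2.2 - (- b * p.1.1.1 - d * p.1.1.2)) ^+ 2)).
    rewrite -!expRD; congr expR.
    rewrite sqnorm_sub_skew// sqnorm_skew// -/W -/a -/b -/d -/(rad2 _) -/(lin _).
    by rewrite /k; field.
  by rewrite /G; ring.
rewrite fubini_tonelli1; last 2 first.
- by rewrite /G /lin /rad2; prove_measurable.
- by move=> p; rewrite lee_fin; apply: mulr_ge0; rewrite ?K0// !mulr_ge0 ?expR_ge0.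
transitivity (fine (\int[lebesgue3]_q ((m ^+ 3 * J ^+ 3)%:E *
    (chi (rad2 q) * expR (k * (W * rad2 q - lin q ^+ 2)))%:E))).
  congr fine; apply: eq_integral => q _; rewrite /fubini_F /G /=.
  under eq_integral do rewrite EFinM.
  rewrite ge0_integralZl; last 4 first.
  - by [].
  - by prove_measurable.
  - by move=> v _; rewrite lee_fin !mulr_ge0 ?expR_ge0.
  - by rewrite lee_fin.
  rewrite integral_gaussian3// -!EFinM -/J; congr EFin; ring.
rewrite ge0_integralZl; last 4 first.
- by [].
- by rewrite /rad2 /lin; prove_measurable.
- by move=> q _; rewrite lee_fin mulr_ge0 ?expR_ge0.
- by rewrite lee_fin; apply: mulr_ge0; apply: exprn_ge0; [exact: ltW|exact: J0].
(* Turns the axis of omega into the third coordinate axis. Since rho^2 = W, the exponent W |q|^2 -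
   (rho q_3)^2 becomes W (q_1^2 + q_2^2), the one treated by [ball_integral]. *)
have [rho rhoE rhoI] := ge0_integral_radial_linear3 d (- b) a.
rewrite (rhoI (fun z => (chi z.1 * expR (k * (W * z.1 - z.2 ^+ 2)))%:E)); last 2 first.
- by prove_measurable.
- by move=> z; rewrite lee_fin mulr_ge0 ?expR_ge0.
have WE : rho ^+ 2 = W.
  by rewrite rhoE /W so3_inner_skew// -/a -/b -/d sqrrN; ring.
have s0 : 0 < sigma by rewrite /sigma mulr_gt0// mulr_gt0.
have -> : (\int[lebesgue3]_q (chi (q.1.1 ^+ 2 + q.1.2 ^+ 2 + q.2 ^+ 2)%R *
     expR (k * (W * (q.1.1 ^+ 2 + q.1.2 ^+ 2 + q.2 ^+ 2) - (rho * q.2) ^+ 2)))%:E =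
   \int[lebesgue3]_q (\1_(`]-oo, rad ^+ 2[) (q.1.1 ^+ 2 + q.1.2 ^+ 2 + q.2 ^+ 2)%R *
      expR (sigma * (q.1.1 ^+ 2 + q.1.2 ^+ 2)))%:E)%E.
  apply: eq_integral => q _; congr (_ * expR _)%:E.
  by rewrite exprMn WE /k /sigma -/W; ring.
rewrite ballE// -EFinM /= /J /k sqrtrM ?ltW// /sigma.
have rb0 : Num.sqrt beta != 0 by rewrite gt_eqF ?sqrtr_gt0.
have rm0 : Num.sqrt (m / 2) != 0 by rewrite gt_eqF ?sqrtr_gt0.
have -> : beta * Num.sqrt beta = Num.sqrt beta ^+ 3.
  by rewrite exprSr sqr_sqrtr ?ltW.
set E := expR _ / _ * _.
by field; rewrite rb0 rm0.
Qed.

End PartitionFunction.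

(** * Derivatives of the potential *)

Section DirectionalDerivatives.
Context {R : realType} {V : normedModType R}.
Implicit Types (f g : V -> R) (x v : V) (df dg : R).

(** Restriction to the line through x in direction v, which makes the one-variable chain rule
    available. *)
Lemma is_derive_line f x v df :
  is_derive x v f df <-> is_derive (0 : R) 1 (fun t : R => f (t *: v + x)) df.
Proof.
have E : (fun h : R => h^-1 *: (((fun t : R => f (t *: v + x)) \o shift 0) (h *: 1)
            - f ((0 : R) *: v + x)))
       = (fun h : R => h^-1 *: ((f \o shift x) (h *: v) - f x)).
  apply/funext => h; rewrite /= !/(shift _ _) /=.
  by rewrite addr0 scale0r add0r [h *: 1]mulr1.
by split => -[d1 d2]; constructor;
  move: d1 d2; rewrite /derivable /derive E.
Qed.

Lemma is_derive_comp1 f (h : R -> R) x v df dh :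
  is_derive x v f df -> is_derive (f x) 1 h dh ->
  is_derive x v (fun y => h (f y)) (dh * df).
Proof.
move=> /is_derive_line fx hx; apply/is_derive_line.
have hx' : is_derive (f ((0 : R) *: v + x)) 1 h dh by rewrite scale0r add0r.
exact: (@is_derive1_comp _ h (fun t : R => f (t *: v + x)) 0 _ _ hx' fx).
Qed.

Lemma is_derive_cst_fun (c : R) x v : is_derive x v (fun=> c) 0.
Proof. exact: is_derive_cst. Qed.

(** This rule and the following ones are phrased for pointwise functions, so that the derivative of
    an explicit expression is assembled by unification with its syntax. *)
Lemma is_derive_add f g x v df dg :
  is_derive x v f df -> is_derive x v g dg ->
  is_derive x v (fun y => f y + g y) (df + dg).
Proof. exact: is_deriveD. Qed.

Lemma is_derive_opp f x v df :
  is_derive x v f df -> is_derive x v (fun y => - f y) (- df).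
Proof. exact: is_deriveN. Qed.

Lemma is_derive_mul f g x v df dg :
  is_derive x v f df -> is_derive x v g dg ->
  is_derive x v (fun y => f y * g y) (df * g x + f x * dg).
Proof.
move=> fx gx; apply: (is_derive_eq (is_deriveM fx gx)).
by rewrite addrC [_ *: _]mulrC.
Qed.

Lemma is_derive_inv f x v df : f x != 0 ->
  is_derive x v f df -> is_derive x v (fun y => (f y)^-1) (- df / f x ^+ 2).
Proof.
move=> fx0 fx; apply: (is_derive_eq (is_derive_comp1 fx (is_deriveV fx0 _))).
by rewrite /GRing.scale /=; field.
Qed.

Lemma is_derive_big (I : Type) (r : seq I) (F : I -> V -> R) (dF : I -> R) x v :
  (forall i, is_derive x v (F i) (dF i)) ->
  is_derive x v (fun y => \sum_(i <- r) F i y) (\sum_(i <- r) dF i).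
Proof.
move=> dFx; elim: r => [|i r IH].
  rewrite big_nil; under eq_fun do rewrite big_nil; exact: is_derive_cst_fun.
rewrite big_cons; under eq_fun do rewrite big_cons; exact: is_derive_add.
Qed.

End DirectionalDerivatives.

(** * Elementary forms on the chart and their derivatives *)

Section Chart.
Context {R : realType}.
Implicit Types (x y : 'rV[R]_4) (a b c : 'I_4).

Local Notation dir a := (delta_mx 0 a : 'rV[R]_4).

Lemma is_derive_coord x a b : is_derive x (dir a) (fun y => y 0 b) (a == b)%:R.
Proof.
apply/is_derive_line.
have -> : (fun t : R => (t *: dir a + x) 0 b) = (fun t => t * (a == b)%:R + x 0 b).
  by apply/funext => t; rewrite !mxE eqxx /= eq_sym.
have idt : is_derive (0 : R) 1 (fun t : R => t) 1 := is_derive_id _ _.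
have := is_derive_add (is_derive_mul idt (is_derive_cst_fun (a == b)%:R (0 : R) (1 : R)))
  (is_derive_cst_fun (x 0 b) (0 : R) (1 : R)).
by rewrite mulr0 mul1r !addr0.
Qed.

Definition rsq x : R := \sum_(i < 3) x 0 (lift ord0 i) ^+ 2.

Definition spin x : R := rsq x / beta_of x.

(** Besides beta > 0 this demands r <> 0, where ln spin is smooth. The region of large spin lies
    inside it. *)
Definition chart_dom x := (0 < beta_of x) && (0 < rsq x).

Lemma continuous_beta : continuous (@beta_of R).
Proof. by move=> x; exact: coord_continuous. Qed.

Lemma continuous_rsq : continuous rsq.
Proof.
have -> : rsq = fun y => y 0 (lift ord0 ord0) ^+ 2 +
    (y 0 (lift ord0 (lift ord0 ord0)) ^+ 2 +
     y 0 (lift ord0 (lift ord0 (lift ord0 ord0))) ^+ 2).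
  by apply/funext => y; rewrite /rsq !big_ord_recl big_ord0 addr0.
have sq i : continuous (fun y : 'rV[R]_4 => y 0 i ^+ 2).
  move=> y; apply: (@continuous_comp _ _ _ (fun y : 'rV[R]_4 => y 0 i) (fun t : R => t ^+ 2)).
    exact: coord_continuous.
  exact: exprn_continuous.
by move=> x; exact: cvgD (sq _ x) (cvgD (sq _ x) (sq _ x)).
Qed.

Lemma near_chart_dom x : chart_dom x -> \forall y \near x, chart_dom y.
Proof.
move=> /andP[b0 r0].
have nb : \forall y \near x, 0 < beta_of y by exact: (cvgr_gt _ (@continuous_beta x) 0 b0).
have nr : \forall y \near x, 0 < rsq y by exact: (cvgr_gt _ (@continuous_rsq x) 0 r0).
by near=> y; apply/andP; split; near: y.
Unshelve. all: by end_near.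
Qed.

(** Closed formulas hold only on [chart_dom]; as that set is open, they may still be differentiated
    there. *)
Lemma partial_chart (f g : 'rV[R]_4 -> R) x a df : chart_dom x ->
  (forall y, chart_dom y -> f y = g y) -> is_derive x (dir a) g df ->
  is_derive x (dir a) f df.
Proof.
move=> xD fg; apply: near_eq_is_derive.
by near=> y; apply/esym/fg; near: y; exact: near_chart_dom.
Unshelve. all: by end_near.
Qed.

(* The coefficients of [d beta / beta], [d ln |r|] and [sum_i dr_i^2 / |r|^2], in
   which every derivative of a function of [spin] is a polynomial; [tau] is
   [d ln spin]. *)
Definition eta a x : R := (a == ord0)%:R / beta_of x.
Definition lam a x : R := (a != ord0)%:R * x 0 a / rsq x.
Definition Qf a b x : R := ((a == b) && (a != ord0))%:R / rsq x.
Definition tau a x : R := 2 * lam a x - eta a x.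

Lemma QfC a b x : Qf a b x = Qf b a x.
Proof. by rewrite /Qf eq_sym; case: eqP => // ->. Qed.

Lemma is_derive_rsq x a : is_derive x (dir a) rsq (2 * (a != ord0)%:R * x 0 a).
Proof.
apply: is_derive_eq.
  apply: is_derive_big => i.
  have dx := is_derive_coord x a (lift ord0 i); exact: (is_derive_mul dx dx).
rewrite /=; case: (unliftP ord0 a) => [j ->|->].
  rewrite [lift ord0 j == ord0]eq_sym neq_lift.
  transitivity (\sum_(i < 3) if i == j then 2 * x 0 (lift ord0 i) else 0).
    apply: eq_bigr => i _; rewrite (inj_eq lift_inj) eq_sym.
    by case: eqP => _ /=; ring.
  by rewrite -big_mkcond /= big_pred1_eq; ring.
rewrite eqxx mulr0 mul0r big1// => i _.
by rewrite (negbTE (neq_lift _ _)) mul0r mulr0 addr0.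
Qed.

Lemma is_derive_eta x a b : chart_dom x ->
  is_derive x (dir a) (eta b) (- (eta a x * eta b x)).
Proof.
move=> /andP[b0 r0]; have bn0 : beta_of x != 0 by rewrite gt_eqF.
apply: is_derive_eq.
  exact: is_derive_mul (is_derive_cst_fun _ _ _)
    (is_derive_inv bn0 (is_derive_coord x a ord0)).
by rewrite /eta /= -/(beta_of x); field.
Qed.

Lemma is_derive_lam x a b : chart_dom x ->
  is_derive x (dir a) (lam b) (Qf a b x - 2 * lam a x * lam b x).
Proof.
move=> /andP[b0 r0]; have bn0 : rsq x != 0 by rewrite gt_eqF.
apply: is_derive_eq.
  apply: is_derive_mul (is_derive_inv bn0 (is_derive_rsq x a)).
  exact: is_derive_mul (is_derive_cst_fun _ _ _) (is_derive_coord x a b).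
rewrite /lam /Qf /=; have [->|ab] := eqVneq a b; rewrite /=; by field.
Qed.

Lemma is_derive_Qf x a b c : chart_dom x ->
  is_derive x (dir a) (Qf b c) (- 2 * lam a x * Qf b c x).
Proof.
move=> /andP[b0 r0]; have bn0 : rsq x != 0 by rewrite gt_eqF.
apply: is_derive_eq.
  exact: is_derive_mul (is_derive_cst_fun _ _ _) (is_derive_inv bn0 (is_derive_rsq x a)).
by rewrite /lam /Qf /=; field.
Qed.

Lemma is_derive_spin x a : chart_dom x ->
  is_derive x (dir a) spin (spin x * tau a x).
Proof.
move=> /andP[b0 r0]; have bn0 : beta_of x != 0 by rewrite gt_eqF.
have rn0 : rsq x != 0 by rewrite gt_eqF.
apply: is_derive_eq.
  exact: is_derive_mul (is_derive_rsq x a) (is_derive_inv bn0 (is_derive_coord x a ord0)).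
by rewrite /spin /tau /lam /eta /= -/(beta_of x); field; rewrite bn0 rn0.
Qed.

(** Writing h' as dh / s makes dh the Euler derivative s h'(s), and the factor s cancels against the
    derivative s * tau of [spin]. Iterated derivatives thus stay polynomial. *)
Lemma is_derive_comp_spin (h : R -> R) (dh : R) x a : chart_dom x ->
  is_derive (spin x) 1 h (dh / spin x) ->
  is_derive x (dir a) (fun y => h (spin y)) (dh * tau a x).
Proof.
move=> xD hx; apply: is_derive_eq.
  exact: is_derive_comp1 (is_derive_spin a xD) hx.
have s0 : spin x != 0 by move/andP: xD => [b0 r0]; rewrite /spin gt_eqF ?divr_gt0.
by field.
Qed.

End Chart.

(** * Decay of the logarithmic derivatives of the incomplete Gamma function *)

Section LowerGamma.
Context {R : realType}.
Local Notation mu := (@lebesgue_measure R).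
Implicit Types x y : R.

Lemma is_derive_lower_gamma x : 0 < x ->
  is_derive x 1 (@lower_gamma R) (Num.sqrt x * expR (- x)).
Proof.
move=> x0.
have x1 : x < x + 1 by rewrite ltrDl.
have [d1 d2] := continuous_FTC1_closed x1 (integrable_sqrt_expRN (x + 1)) x0
  (@continuous_sqrt_expRN R x).
by constructor; [exact: d1|rewrite -derive1E; exact: d2].
Qed.

Lemma lower_gamma_le x y : 0 <= x -> x <= y -> lower_gamma x <= lower_gamma y.
Proof.
move=> x0 xy; rewrite -lee_fin !lower_gammaE.
have msq : measurable_fun setT (fun y : R => Num.sqrt y * expR (- y)).
  by apply: continuous_measurable_fun; exact: continuous_sqrt_expRN.
apply: ge0_le_integral => //.
- by apply/measurable_EFinP; apply: measurable_funM => //; exact: measurable_indic.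
- by apply/measurable_EFinP; apply: measurable_funM => //; exact: measurable_indic.
move=> t _; rewrite lee_fin ler_wpM2r// ?mulr_ge0 ?expR_ge0 ?sqrtr_ge0//.
rewrite !indicE ler_nat; case: (boolP (t \in `[0, x]%classic)) => //.
rewrite inE /= in_itv /= => /andP[t0 tx].
by rewrite mem_set//= in_itv /= t0 (le_trans tx xy).
Qed.

(** On [[x / 2, x]] the integrand is at least sqrt (x / 2) * exp (- x). *)
Lemma lower_gamma_gt0 x : 0 < x -> 0 < lower_gamma x.
Proof.
move=> x0; have x20 : 0 < x / 2 by rewrite divr_gt0.
have c0 : 0 < Num.sqrt (x / 2) * expR (- x) by rewrite mulr_gt0 ?sqrtr_gt0 ?expR_gt0.
rewrite -lte_fin lower_gammaE.
have msq : measurable_fun setT (fun y : R => Num.sqrt y * expR (- y)).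
  by apply: continuous_measurable_fun; exact: continuous_sqrt_expRN.
apply: (@lt_le_trans _ _ (\int[mu]_y (Num.sqrt (x / 2) * expR (- x) *
    \1_(`[x / 2, x]%classic) y)%:E)%E).
  under eq_integral do rewrite EFinM.
  rewrite ge0_integralZl; last 4 first.
  - by [].
  - by apply/measurable_EFinP; exact: measurable_indic.
  - by move=> t _; rewrite lee_fin indicE.
  - by rewrite lee_fin ltW.
  rewrite integral_indic//= setIT lebesgue_measure_itv /= lte_fin.
  have -> : x / 2 < x by lra.
  by rewrite -EFinD -EFinM lte_fin mulr_gt0//; lra.
apply: ge0_le_integral => //.
- by apply/measurable_EFinP; apply: measurable_funM => //; exact: measurable_indic.
- by apply/measurable_EFinP; apply: measurable_funM => //; exact: measurable_indic.
move=> t _; rewrite lee_fin !indicE.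
case: (boolP (t \in `[x / 2, x]%classic)) => [|_]; last first.
  by rewrite mulr0 !mulr_ge0 ?sqrtr_ge0 ?expR_ge0.
rewrite inE /= in_itv /= => /andP[t0 tx].
have t0' : 0 <= t by rewrite (le_trans (ltW x20)).
rewrite mem_set /= ?in_itv /= ?t0' ?tx// mulr1 mul1r.
by rewrite ler_pM ?sqrtr_ge0 ?expR_ge0 ?ler_sqrt ?ler_expR ?lerN2.
Qed.

(* [kap], ..., [kap4] are the iterated Euler derivatives (x d/dx) of
   [ln (lower_gamma x)]. *)
Definition kap x : R := x * Num.sqrt x * expR (- x) / lower_gamma x.

Definition kap2 x : R := kap x * (3 / 2 - x - kap x).
Definition kap3 x : R := kap2 x * (3 / 2 - x - kap x) + kap x * (- x - kap2 x).
Definition kap4 x : R := kap3 x * (3 / 2 - x - kap x)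
  + 2 * kap2 x * (- x - kap2 x) + kap x * (- x - kap3 x).

Lemma is_derive_idR (x : R) : is_derive x 1 (fun t : R => t) 1.
Proof. exact: is_derive_id. Qed.

(** Logarithmic differentiation: x d/dx of ln [kap] is 3/2 - x - [kap], the last term being x d/dx
    of ln [lower_gamma]. *)
Lemma is_derive_kap x : 0 < x -> is_derive x 1 kap (kap2 x / x).
Proof.
move=> x0; have g0 := lower_gamma_gt0 x0.
have gn0 : lower_gamma x != 0 by rewrite gt_eqF.
have s0 : Num.sqrt x != 0 by rewrite gt_eqF ?sqrtr_gt0.
have ds := is_derive1_sqrt x0.
have de : is_derive x 1 (fun t : R => expR (- t)) (expR (- x) * - 1).
  exact: is_derive_comp1 (is_derive_opp (is_derive_idR x)) (is_derive_expR _).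
apply: is_derive_eq.
  exact: is_derive_mul (is_derive_mul (is_derive_mul (is_derive_idR x) ds) de)
    (is_derive_inv gn0 (is_derive_lower_gamma x0)).
rewrite /kap2 /kap.
set G := lower_gamma x in gn0 *.
(* With x written as the square of q the identity becomes rational. *)
set q := Num.sqrt x in s0 *; have -> : x = q ^+ 2 by rewrite sqr_sqrtr ?ltW.
set E := expR _.
by field; rewrite s0 gn0.
Qed.

Lemma is_derive_kap2 x : 0 < x -> is_derive x 1 kap2 (kap3 x / x).
Proof.
move=> x0; have dk := is_derive_kap x0; have xn0 : x != 0 by rewrite gt_eqF.
by apply: is_derive_eq; rewrite /GRing.scale /= /kap3; field.
Qed.

Lemma is_derive_kap3 x : 0 < x -> is_derive x 1 kap3 (kap4 x / x).
Proof.
move=> x0; have dk := is_derive_kap x0; have xn0 : x != 0 by rewrite gt_eqF.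
have dk2 := is_derive_kap2 x0.
by apply: is_derive_eq; rewrite /GRing.scale /= /kap4; field.
Qed.

(** From exp x >= x^6 / 6!, sqrt x <= x and [lower_gamma] x >= [lower_gamma] 1. Two of the six
    powers are spent on x * sqrt x <= x^2, and the remaining x^-4 absorbs every factor x^k with k <=
    3. *)
Lemma kap_le x : 1 <= x -> 0 <= kap x <= 6`!%:R / lower_gamma 1 / x ^+ 4.
Proof.
move=> x1; have x0 : 0 < x by lra.
have g1 : 0 < lower_gamma (1 : R) by exact: lower_gamma_gt0.
have gx := lower_gamma_gt0 x0.
have sx : Num.sqrt x <= x.
  rewrite -ler_sqr ?nnegrE ?sqrtr_ge0 ?(ltW x0)// sqr_sqrtr ?(ltW x0)// expr2.
  exact: ler_peMl (ltW x0) x1.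
apply/andP; split; first by rewrite /kap divr_ge0 ?mulr_ge0 ?sqrtr_ge0 ?expR_ge0 ?ltW.
have c0 : 0 < (6`!%:R : R) by rewrite ltr0n fact_gt0.
have := @expR_ge1Dxn R x 5 (ltW x0).
set c : R := _%:R in c0 *; move=> exc.
have ex : expR (- x) <= c / x ^+ 6.
  rewrite expRN -[leRHS]invrK lef_pV2 ?posrE ?expR_gt0 ?invr_gt0 ?divr_gt0 ?exprn_gt0//.
  by rewrite invf_div (le_trans _ exc)// lerDr.
have -> : c / lower_gamma 1 / x ^+ 4 = x * x * (c / x ^+ 6) / lower_gamma 1.
  by field; rewrite !gt_eqF.
rewrite /kap ler_pM ?lef_pV2 ?posrE ?invr_ge0 ?(ltW gx) ?lower_gamma_le//.
  by rewrite !mulr_ge0 ?sqrtr_ge0 ?expR_ge0 ?ltW.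
by rewrite ler_pM ?expR_ge0 ?mulr_ge0 ?sqrtr_ge0 ?(ltW x0)// ler_pM2l.
Qed.

Local Open Scope classical_set_scope.

Lemma cvg_pow_kap (k : nat) : (k <= 3)%N -> x ^+ k * kap x @[x --> +oo] --> (0 : R).
Proof.
move=> k3; pose C : R := 6`!%:R / lower_gamma 1.
have C0 : 0 < C by rewrite divr_gt0 ?lower_gamma_gt0// ltr0n fact_gt0.
apply/cvgrPdist_lt => eps eps0; near=> x.
have x1 : 1 <= x by near: x; exact: nbhs_pinfty_ge.
have x0 : 0 < x by lra.
have xC : C / eps < x by near: x; apply: nbhs_pinfty_gt; exact: num_real.
have /andP[k0] := kap_le x1; rewrite -/C => kC.
rewrite sub0r normrN ger0_norm; last exact: mulr_ge0 (exprn_ge0 _ (ltW x0)) k0.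
have xk : x ^+ k <= x ^+ 3 by rewrite ler_weXn2l.
apply: (@le_lt_trans _ _ (x ^+ 3 * (C / x ^+ 4))).
  by rewrite ler_pM ?exprn_ge0 ?(ltW x0).
have -> : x ^+ 3 * (C / x ^+ 4) = C / x by field; rewrite gt_eqF.
by rewrite ltr_pdivrMr// mulrC -ltr_pdivrMr.
Unshelve. all: by end_near.
Qed.

Lemma cvg_kap : kap x @[x --> +oo] --> (0 : R).
Proof.
have := @cvg_pow_kap 0 isT.
by under eq_fun do rewrite expr0 mul1r.
Qed.

Lemma cvg_xkap : x * kap x @[x --> +oo] --> (0 : R).
Proof.
have := @cvg_pow_kap 1 isT.
by under eq_fun do rewrite expr1.
Qed.

(** [kap2] and [kap3] are polynomials in x and [kap] in which every monomial contains [kap], so the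
    decay of x^k * [kap] decides all these limits. *)
Lemma cvg_xkap2 : x * kap2 x @[x --> +oo] --> (0 : R).
Proof.
have E x : x * kap2 x = 3 / 2 * (x * kap x) - x ^+ 2 * kap x - x * kap x * kap x.
  by rewrite /kap2; ring.
under eq_fun do rewrite E.
have -> : (0 : R) = 3 / 2 * 0 - 0 - 0 * 0 by ring.
apply: cvgB; last exact: cvgM cvg_xkap cvg_kap.
apply: cvgB; last exact: cvg_pow_kap.
by apply: cvgM; [exact: cvg_cst|exact: cvg_xkap].
Qed.

Lemma cvg_kap2 : kap2 x @[x --> +oo] --> (0 : R).
Proof.
have E x : kap2 x = 3 / 2 * kap x - x * kap x - kap x * kap x.
  by rewrite /kap2; ring.
under eq_fun do rewrite E.
have -> : (0 : R) = 3 / 2 * 0 - 0 - 0 * 0 by ring.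
apply: cvgB; last exact: cvgM cvg_kap cvg_kap.
apply: cvgB; last exact: cvg_xkap.
by apply: cvgM; [exact: cvg_cst|exact: cvg_kap].
Qed.

Lemma cvg_kap3 : kap3 x @[x --> +oo] --> (0 : R).
Proof.
have E x : kap3 x = 3 / 2 * kap2 x - x * kap2 x - 2 * (kap x * kap2 x) - x * kap x.
  by rewrite /kap3; ring.
under eq_fun do rewrite E.
have -> : (0 : R) = 3 / 2 * 0 - 0 - 2 * (0 * 0) - 0 by ring.
apply: cvgB; last exact: cvg_xkap.
apply: cvgB.
  apply: cvgB; last exact: cvg_xkap2.
  by apply: cvgM; [exact: cvg_cst|exact: cvg_kap2].
by apply: cvgM; [exact: cvg_cst|exact: cvgM cvg_kap cvg_kap2].
Qed.

End LowerGamma.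

(** * The potential and its derivatives up to order four *)

Section PotentialDerivatives.
Context {R : realType} (m rad : R) (e : 'I_3 -> 'M[R]_3).
Hypotheses (m_gt0 : 0 < m) (rad_gt0 : 0 < rad) (e_basis : so3_orthonormal_basis e).
Implicit Types (x y : 'rV[R]_4) (a b c d : 'I_4).
Local Notation dir a := (delta_mx 0 a : 'rV[R]_4).

Lemma omega_of_skew x : (omega_of e x)^T = - omega_of e x.
Proof.
rewrite /omega_of linear_sum -sumrN; apply: eq_bigr => i _.
by rewrite linearZ /= e_basis.1 scalerN.
Qed.

Lemma so3_inner_omega x :
  so3_inner (omega_of e x) (omega_of e x) = \sum_i omega_coord i x ^+ 2.
Proof.
rewrite /so3_inner /omega_of mulmx_suml linear_sum mulr_sumr.
apply: eq_bigr => i _; rewrite mulmx_sumr linear_sum mulr_sumr (bigD1 i)//=.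
have trE j : - 2^-1 * \tr (omega_coord i x *: e i *m (omega_coord j x *: e j)) =
    omega_coord i x * omega_coord j x * (i == j)%:R.
  rewrite -e_basis.2 /so3_inner -scalemxAl -scalemxAr !linearZ /=.
  by ring.
rewrite trE eqxx mulr1 big1 ?addr0 ?expr2// => j ji.
by rewrite trE eq_sym (negbTE ji) mulr0.
Qed.

Lemma spinE x : 0 < beta_of x ->
  beta_of x * so3_inner (omega_of e x) (omega_of e x) = spin x.
Proof.
move=> b0; rewrite so3_inner_omega mulr_sumr /spin /rsq mulr_suml.
apply: eq_bigr => i _; rewrite /omega_coord; field.
by rewrite gt_eqF.
Qed.

Lemma spin_gt0 x : chart_dom x -> 0 < spin x.
Proof. by move=> /andP[b0 r0]; rewrite divr_gt0. Qed.

Definition half_inertia : R := m * rad ^+ 2 / 2.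
Local Notation al := half_inertia.

Lemma half_inertia_gt0 : 0 < al.
Proof. by rewrite divr_gt0// mulr_gt0 ?exprn_gt0. Qed.

Definition phi (s : R) : R := al * s - ln (m / 2 * s * Num.sqrt (m / 2 * s))
  + ln (lower_gamma (al * s)).
(* [phi1], ..., [phi4] are the iterated Euler derivatives (s d/ds) of [phi]. *)
Definition phi1 (s : R) : R := al * s - 3 / 2 + kap (al * s).
Definition phi2 (s : R) : R := al * s + kap2 (al * s).
Definition phi3 (s : R) : R := al * s + kap3 (al * s).
Definition phi4 (s : R) : R := al * s + kap4 (al * s).

Lemma potentialE : exists C : R, forall x, chart_dom x ->
  potential m rad e x =
  C - ln (beta_of x * Num.sqrt (beta_of x)) + phi (spin x).
Proof.
have [C C0 ZE] := partition_functionE rad m_gt0.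
exists (ln C) => x xD; have s0 := spin_gt0 xD; move/andP: (xD) => [b0 r0].
have W0 : 0 < so3_inner (omega_of e x) (omega_of e x).
  by move: s0; rewrite -spinE// pmulr_rgt0.
rewrite /potential ZE ?omega_of_skew// spinE//.
have -> : m / 2 * spin x * rad ^+ 2 = al * spin x by rewrite /al; ring.
have g0 : 0 < lower_gamma (al * spin x).
  by apply: lower_gamma_gt0; rewrite mulr_gt0// half_inertia_gt0.
have bb0 : 0 < beta_of x * Num.sqrt (beta_of x) by rewrite mulr_gt0 ?sqrtr_gt0.
have sg0 : 0 < m / 2 * spin x by rewrite mulr_gt0// divr_gt0.
have ss0 : 0 < m / 2 * spin x * Num.sqrt (m / 2 * spin x).
  by rewrite mulr_gt0 ?sqrtr_gt0.
set bb := _ * Num.sqrt (beta_of x) in bb0 *.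
set ss := _ * Num.sqrt (m / 2 * spin x) in ss0 *.
have p1 : 0 < C / bb by rewrite divr_gt0.
have p2 : 0 < expR (al * spin x) / ss by rewrite divr_gt0 ?expR_gt0.
have p3 : 0 < expR (al * spin x) / ss * lower_gamma (al * spin x) by rewrite mulr_gt0.
have -> : ln (C / bb * (expR (al * spin x) / ss * lower_gamma (al * spin x))) =
    ln (C / bb) + ln (expR (al * spin x) / ss * lower_gamma (al * spin x)).
  by rewrite lnM ?posrE.
have -> : ln (expR (al * spin x) / ss * lower_gamma (al * spin x)) =
    ln (expR (al * spin x) / ss) + ln (lower_gamma (al * spin x)).
  by rewrite lnM ?posrE.
have -> : ln (C / bb) = ln C - ln bb by rewrite ln_div ?posrE.
by rewrite ln_div ?posrE ?expR_gt0// expRK.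
Qed.

Lemma is_derive_ln_pow32 (t : R) : 0 < t ->
  is_derive t 1 (fun t : R => ln (t * Num.sqrt t)) (3 / 2 / t).
Proof.
move=> t0; have s0 : Num.sqrt t != 0 by rewrite gt_eqF ?sqrtr_gt0.
have ts0 : 0 < t * Num.sqrt t by rewrite mulr_gt0 ?sqrtr_gt0.
apply: is_derive_eq.
  exact: is_derive_comp1 (is_derive_mul (is_derive_idR t) (is_derive1_sqrt t0))
    (is_derive1_ln ts0).
set q := Num.sqrt t in s0 *; have -> : t = q ^+ 2 by rewrite sqr_sqrtr ?ltW.
by field.
Qed.

Lemma is_derive_scale (k : R) (h : R -> R) (dh s : R) :
  is_derive (k * s) 1 h dh -> is_derive s 1 (fun s => h (k * s)) (dh * k).
Proof.
move=> hks; have d := is_derive_mul (is_derive_cst_fun k s 1) (is_derive_idR s).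
apply: (is_derive_eq (is_derive_comp1 d hks)).
by ring.
Qed.

Section Spin.
Variable (s : R).
Hypothesis s_gt0 : 0 < s.
Let als_gt0 : 0 < al * s. Proof. by rewrite mulr_gt0// half_inertia_gt0. Qed.
Let al_neq0 : al != 0. Proof. by rewrite gt_eqF// half_inertia_gt0. Qed.
Let s_neq0 : s != 0. Proof. by rewrite gt_eqF. Qed.

Lemma is_derive_phi : is_derive s 1 phi (phi1 s / s).
Proof.
have sg0 : 0 < m / 2 * s by rewrite mulr_gt0// divr_gt0.
have g0 := lower_gamma_gt0 als_gt0; have gn0 : lower_gamma (al * s) != 0 by rewrite gt_eqF.
have m0 : m != 0 by rewrite gt_eqF.
have d1 := is_derive_scale (is_derive_ln_pow32 sg0).
have d2 := is_derive_scale
  (is_derive_comp1 (is_derive_lower_gamma als_gt0) (is_derive1_ln g0)).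
have d0 := is_derive_scale (is_derive_idR (al * s)).
apply: is_derive_eq; rewrite /GRing.scale /= /phi1 /kap; field.
by rewrite gn0 s_neq0 m0.
Qed.

Lemma is_derive_phi1 : is_derive s 1 phi1 (phi2 s / s).
Proof.
have d1 := is_derive_scale (is_derive_kap als_gt0).
have d0 := is_derive_scale (is_derive_idR (al * s)).
by apply: is_derive_eq; rewrite /GRing.scale /= /phi2; field; rewrite al_neq0 s_neq0.
Qed.

Lemma is_derive_phi2 : is_derive s 1 phi2 (phi3 s / s).
Proof.
have d1 := is_derive_scale (is_derive_kap2 als_gt0).
have d0 := is_derive_scale (is_derive_idR (al * s)).
by apply: is_derive_eq; rewrite /GRing.scale /= /phi3; field; rewrite al_neq0 s_neq0.
Qed.

Lemma is_derive_phi3 : is_derive s 1 phi3 (phi4 s / s).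
Proof.
have d1 := is_derive_scale (is_derive_kap3 als_gt0).
have d0 := is_derive_scale (is_derive_idR (al * s)).
by apply: is_derive_eq; rewrite /GRing.scale /= /phi4; field; rewrite al_neq0 s_neq0.
Qed.

End Spin.

(** The Hessian of ln spin, that is, the derivative of [tau]; [DBf] is the third derivative of ln
    spin. *)
Definition Bf a b x : R := 2 * Qf a b x - 4 * lam a x * lam b x + eta a x * eta b x.

Definition DBf c a b x : R :=
  - 4 * (lam c x * Qf a b x + lam a x * Qf c b x + lam b x * Qf c a x)
  + 16 * lam c x * lam a x * lam b x - 2 * eta c x * eta a x * eta b x.

(** Faa di Bruno's formula for phi as a function of ln spin, plus the Hessian 3/2 eta eta of - 3/2
    ln beta. [cubicf] and [quarticf] continue it to orders three and four. *)
Definition hessf a b x : R := 3 / 2 * eta a x * eta b x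
  + phi2 (spin x) * tau a x * tau b x + phi1 (spin x) * Bf a b x.

Definition cubicf c a b x : R := - 3 * eta c x * eta a x * eta b x
  + phi3 (spin x) * tau c x * tau a x * tau b x
  + phi2 (spin x) * (tau c x * Bf a b x + tau a x * Bf c b x + tau b x * Bf c a x)
  + phi1 (spin x) * DBf c a b x.

Lemma is_derive_tau x a b : chart_dom x -> is_derive x (dir a) (tau b) (Bf a b x).
Proof.
move=> xD; have d1 := is_derive_lam a b xD; have d2 := is_derive_eta a b xD.
apply: is_derive_eq; rewrite /GRing.scale /= /Bf; ring.
Qed.

Lemma is_derive_Bf x c a b : chart_dom x -> is_derive x (dir c) (Bf a b) (DBf c a b x).
Proof.
move=> xD; have d1 := is_derive_lam c a xD; have d2 := is_derive_lam c b xD.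
have d3 := is_derive_eta c a xD; have d4 := is_derive_eta c b xD.
have d5 := is_derive_Qf c a b xD.
apply: is_derive_eq; rewrite /GRing.scale /= /DBf; ring.
Qed.

Lemma is_derive_potential x a : chart_dom x ->
  is_derive x (dir a) (potential m rad e) (- (3 / 2) * eta a x + phi1 (spin x) * tau a x).
Proof.
move=> xD; move/andP: (xD) => [b0 r0]; have s0 := spin_gt0 xD.
have [C potE] := potentialE; apply: (partial_chart xD potE).
have d1 := is_derive_comp_spin a xD (is_derive_phi s0).
have d2 := is_derive_comp1 (is_derive_coord x a ord0) (is_derive_ln_pow32 b0).
by apply: is_derive_eq; rewrite /eta /beta_of eq_sym; ring.
Qed.

Lemma gas_metricE x a b : chart_dom x -> gas_metric m rad e x a b = hessf a b x.
Proof.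
move=> xD; rewrite /gas_metric /hessian mxE /partial.
have s0 := spin_gt0 xD.
suff: is_derive x (dir a) (fun y => 'D_(dir b) (potential m rad e) y) (hessf a b x).
  by move=> ?; exact: derive_val.
apply: (partial_chart xD (g := fun y => - (3 / 2) * eta b y + phi1 (spin y) * tau b y)).
  by move=> y yD; have := is_derive_potential b yD; move=> ?; exact: derive_val.
have d1 := is_derive_comp_spin a xD (is_derive_phi1 s0).
have d2 := is_derive_eta a b xD; have d3 := is_derive_tau a b xD.
by apply: is_derive_eq; rewrite /GRing.scale /= /hessf; ring.
Qed.

Lemma is_derive_gas_metric x c a b : chart_dom x ->
  is_derive x (dir c) (fun y => gas_metric m rad e y a b) (cubicf c a b x).
Proof.
move=> xD; have s0 := spin_gt0 xD.
apply: (partial_chart xD (g := hessf a b)) => [y yD|]; first exact: gas_metricE.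
have d1 := is_derive_comp_spin c xD (is_derive_phi1 s0).
have d2 := is_derive_comp_spin c xD (is_derive_phi2 s0).
have d3 := is_derive_eta c a xD; have d4 := is_derive_eta c b xD.
have d5 := is_derive_tau c a xD; have d6 := is_derive_tau c b xD.
have d7 := is_derive_Bf c a b xD.
by apply: is_derive_eq; rewrite /GRing.scale /= /cubicf; field.
Qed.

Lemma cubicf_sym12 c a b x : cubicf c a b x = cubicf a c b x.
Proof. by rewrite /cubicf /DBf /Bf [Qf c a x]QfC [Qf c b x]QfC; ring. Qed.

Lemma cubicf_sym23 c a b x : cubicf c a b x = cubicf c b a x.
Proof. by rewrite /cubicf /DBf /Bf [Qf a b x]QfC; ring. Qed.

(** It makes the Christoffel symbols differentiable, and its symmetry is what removes fourth
    derivatives from the curvature. The factor of [phi1] is the fourth derivative of ln spin. *)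
Definition quarticf d c a b x : R :=
  9 * eta d x * eta c x * eta a x * eta b x
  + phi4 (spin x) * tau d x * tau c x * tau a x * tau b x
  + phi3 (spin x) *
    (Bf d c x * tau a x * tau b x + Bf d a x * tau c x * tau b x
     + Bf d b x * tau c x * tau a x + Bf c a x * tau d x * tau b x
     + Bf c b x * tau d x * tau a x + Bf a b x * tau d x * tau c x)
  + phi2 (spin x) *
    (Bf d c x * Bf a b x + Bf d a x * Bf c b x + Bf d b x * Bf c a x
     + tau d x * DBf c a b x + tau c x * DBf d a b x
     + tau a x * DBf d c b x + tau b x * DBf d c a x)
  + phi1 (spin x) *
    (- 4 * (Qf d c x * Qf a b x + Qf d a x * Qf c b x + Qf d b x * Qf c a x)
     + 16 * (lam d x * lam c x * Qf a b x + lam d x * lam a x * Qf c b x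
            + lam d x * lam b x * Qf c a x + lam c x * lam a x * Qf d b x
            + lam c x * lam b x * Qf d a x + lam a x * lam b x * Qf d c x)
     - 96 * lam d x * lam c x * lam a x * lam b x
     + 6 * eta d x * eta c x * eta a x * eta b x).

Lemma is_derive_cubicf x d c a b : chart_dom x ->
  is_derive x (dir d) (cubicf c a b) (quarticf d c a b x).
Proof.
move=> xD; have s0 := spin_gt0 xD.
have p1 := is_derive_comp_spin d xD (is_derive_phi1 s0).
have p2 := is_derive_comp_spin d xD (is_derive_phi2 s0).
have p3 := is_derive_comp_spin d xD (is_derive_phi3 s0).
have eE i := is_derive_eta d i xD.
have tE i := is_derive_tau d i xD.
have lE i := is_derive_lam d i xD.
have qE i j := is_derive_Qf d i j xD.
have bE i j := is_derive_Bf d i j xD.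
have cE k := is_derive_cst_fun k x (dir d).
have dDB : is_derive x (dir d) (DBf c a b)
    (- 4 * (Qf d c x * Qf a b x + Qf d a x * Qf c b x + Qf d b x * Qf c a x)
     + 16 * (lam d x * lam c x * Qf a b x + lam d x * lam a x * Qf c b x
            + lam d x * lam b x * Qf c a x + lam c x * lam a x * Qf d b x
            + lam c x * lam b x * Qf d a x + lam a x * lam b x * Qf d c x)
     - 96 * lam d x * lam c x * lam a x * lam b x
     + 6 * eta d x * eta c x * eta a x * eta b x).
  by apply: is_derive_eq; rewrite /GRing.scale /=; ring.
by apply: is_derive_eq; rewrite /GRing.scale /= /quarticf; ring.
Qed.

Lemma quarticf_sym13 d c a b x : quarticf d c a b x = quarticf a c d b x.
Proof.
rewrite /quarticf /DBf /Bf [Qf d a x]QfC [Qf d c x]QfC [Qf c a x]QfC; ring.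
Qed.

End PotentialDerivatives.

(** * Curvature of a Hessian metric *)

Section MatrixLimits.
Context {R : realType}.
Local Open Scope classical_set_scope.

Lemma cvg_bigsum (T I : Type) (F : set_system T) (FF : Filter F) (r : seq I)
    (f : I -> T -> R) (l : I -> R) :
  (forall i, f i x @[x --> F] --> l i) ->
  \sum_(i <- r) f i x @[x --> F] --> \sum_(i <- r) l i.
Proof.
move=> fl; elim: r => [|i r IH].
  rewrite big_nil; under eq_fun do rewrite big_nil; exact: cvg_cst.
rewrite big_cons; under eq_fun do rewrite big_cons.
by apply: cvgD.
Qed.

Lemma cvg_bigprod (T I : Type) (F : set_system T) (FF : Filter F) (r : seq I)
    (f : I -> T -> R) (l : I -> R) :
  (forall i, f i x @[x --> F] --> l i) ->
  \prod_(i <- r) f i x @[x --> F] --> \prod_(i <- r) l i.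
Proof.
move=> fl; elim: r => [|i r IH].
  rewrite big_nil; under eq_fun do rewrite big_nil; exact: cvg_cst.
rewrite big_cons; under eq_fun do rewrite big_cons.
by apply: cvgM.
Qed.

Lemma cvg_det (T : Type) (F : set_system T) (FF : Filter F) n
    (M : T -> 'M[R]_n) (L : 'M[R]_n) :
  (forall i j, M x i j @[x --> F] --> L i j) ->
  \det (M x) @[x --> F] --> \det L.
Proof.
move=> ML; apply: cvg_bigsum => s; apply: cvgM; first exact: cvg_cst.
exact: cvg_bigprod.
Qed.

(** Determinants and cofactors are polynomials in the entries. The cofactor formula describes
    [invmx] only at invertible matrices, since [invmx] returns a singular matrix unchanged; a
    nonzero limit determinant ensures invertibility eventually. *)
Lemma cvg_invmx (T : Type) (F : set_system T) (FF : Filter F) n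
    (M : T -> 'M[R]_n) (L : 'M[R]_n) : L \in unitmx ->
  (forall i j, M x i j @[x --> F] --> L i j) ->
  forall i j, invmx (M x) i j @[x --> F] --> invmx L i j.
Proof.
move=> Lu ML i j; have detL := cvg_det FF ML.
have L0 : \det L != 0 by rewrite -unitfE -unitmxE.
have Mu : \forall x \near F, M x \in unitmx.
  have H := cvgr_neq0 _ detL L0.
  by near=> x; rewrite unitmxE unitfE; near: x; exact: H.
have -> : invmx L i j = (\det L)^-1 * cofactor L j i by rewrite /invmx Lu !mxE.
apply: (@cvg_trans _ ((fun x => (\det (M x))^-1 * cofactor (M x) j i) x @[x --> F])).
  apply: near_eq_cvg; near=> x; have Mxu : M x \in unitmx by near: x; exact: Mu.
  by rewrite /invmx Mxu !mxE.
apply: cvgM; first exact: cvgV.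
apply: cvgM; first exact: cvg_cst.
apply: cvg_det => i' j'; under eq_fun do rewrite !mxE; rewrite !mxE.
exact: ML.
Unshelve. all: by end_near.
Qed.

End MatrixLimits.

Section MatrixDerivatives.
Context {R : realType} {V : normedModType R}.
Implicit Types (x v : V).

Lemma derivable_bigsum (I : Type) (r : seq I) (f : I -> V -> R) x v :
  (forall i, derivable (f i) x v) -> derivable (fun y => \sum_(i <- r) f i y) x v.
Proof.
move=> df; elim: r => [|i r IH].
  under eq_fun do rewrite big_nil; exact: derivable_cst.
by under eq_fun do rewrite big_cons; exact: derivableD.
Qed.

Lemma derivable_bigprod (I : Type) (r : seq I) (f : I -> V -> R) x v :
  (forall i, derivable (f i) x v) -> derivable (fun y => \prod_(i <- r) f i y) x v.
Proof.
move=> df; elim: r => [|i r IH].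
  under eq_fun do rewrite big_nil; exact: derivable_cst.
by under eq_fun do rewrite big_cons; exact: derivableM.
Qed.

Lemma derivable_det n (M : V -> 'M[R]_n) x v :
  (forall i j, derivable (fun y => M y i j) x v) ->
  derivable (fun y => \det (M y)) x v.
Proof.
move=> dM; apply: derivable_bigsum => s; apply: derivableM.
  exact: derivable_cst.
exact: derivable_bigprod.
Qed.

Lemma derivable_invmx n (M : V -> 'M[R]_n) x v :
  (\forall y \near x, M y \in unitmx) ->
  (forall i j, derivable (fun y => M y i j) x v) ->
  forall i j, derivable (fun y => invmx (M y) i j) x v.
Proof.
move=> Mu dM i j.
apply: (@near_eq_derivable _ _ _ (fun y => (\det (M y))^-1 * cofactor (M y) j i)).
  by apply: filterS Mu => y Myu; rewrite /invmx Myu !mxE.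
have Mxu : M x \in unitmx by exact: nbhs_singleton Mu.
apply: derivableM.
  have d0 : \det (M x) != 0 by rewrite -unitfE -unitmxE.
  have /derivableP d := derivable_det dM.
  by have := is_derive_inv (f := fun y => \det (M y)) d0 d; case.
apply: derivableM; first exact: derivable_cst.
apply: derivable_det => i' j'; under eq_fun do rewrite !mxE.
exact: dM.
Qed.

(** Cofactors show that the derivative exists; its value comes from differentiating M^-1 M = 1. *)
Lemma is_derive_invmx n (M : V -> 'M[R]_n) (dM : 'M[R]_n) x v :
  (\forall y \near x, M y \in unitmx) ->
  (forall i j, is_derive x v (fun y => M y i j) (dM i j)) ->
  forall i j, is_derive x v (fun y => invmx (M y) i j)
    ((- (invmx (M x) *m dM *m invmx (M x))) i j).
Proof.
move=> Mu dMx.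
have dI i j : derivable (fun y => invmx (M y) i j) x v.
  by apply: derivable_invmx => // i' j'; case: (dMx i' j').
pose dK : 'M[R]_n := \matrix_(i, j) 'D_v (fun y => invmx (M y) i j) x.
have dKx i j : is_derive x v (fun y => invmx (M y) i j) (dK i j).
  by constructor; [exact: dI|rewrite mxE].
have Mxu : M x \in unitmx by exact: nbhs_singleton Mu.
have prod0 : dK *m M x + invmx (M x) *m dM = 0.
  apply/matrixP => i j; rewrite !mxE -big_split /=.
  have d1 : is_derive x v (fun y => \sum_l invmx (M y) i l * M y l j)
      (\sum_l (dK i l * M x l j + invmx (M x) i l * dM l j)).
    by apply: is_derive_big => l; exact: is_derive_mul.
  have d2 : is_derive x v (fun y => \sum_l invmx (M y) i l * M y l j) 0.
    apply: (@near_eq_is_derive R V R (fun=> (i == j)%:R)).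
      apply: filterS Mu => y Myu.
      by have := congr1 (fun A : 'M[R]_n => A i j) (mulVmx Myu); rewrite !mxE.
  by rewrite -(@derive_val _ _ _ _ _ _ _ d1) (@derive_val _ _ _ _ _ _ _ d2).
have dKE : dK = - (invmx (M x) *m dM *m invmx (M x)).
  apply/eqP; rewrite -addr_eq0 -[dK](mulmxK Mxu) -mulmxDl prod0 mul0mx//.
by move=> i j; rewrite -dKE.
Qed.

End MatrixDerivatives.

(** * The curvature formula from third derivatives *)

Section HessianCurvature.
Context {R : realType} {n : nat}.
Implicit Types (a b c d k l : 'I_n.+1).
Variables (g : 'rV[R]_n.+1 -> 'M[R]_n.+1) (x : 'rV[R]_n.+1).
Variable T : 'I_n.+1 -> 'I_n.+1 -> 'I_n.+1 -> 'rV[R]_n.+1 -> R.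
Variable T4 : 'I_n.+1 -> 'I_n.+1 -> 'I_n.+1 -> 'I_n.+1 -> R.
Hypothesis g_unit : \forall y \near x, g y \in unitmx.
Hypothesis dg : \forall y \near x, forall c a b,
  is_derive y (delta_mx 0 c : 'rV[R]_n.+1) (fun z => g z a b) (T c a b y).
Hypothesis T_sym12 : forall c a b y, T c a b y = T a c b y.
Hypothesis T_sym23 : forall c a b y, T c a b y = T c b a y.
Hypothesis dT : forall d c a b,
  is_derive x (delta_mx 0 d : 'rV[R]_n.+1) (T c a b) (T4 d c a b).
Hypothesis T4_sym : forall d c a b, T4 d c a b = T4 a c d b.

Local Notation K := (invmx (g x)).
Local Notation dir c := (delta_mx 0 c : 'rV[R]_n.+1).
Let Tm c : 'M[R]_n.+1 := \matrix_(a, b) T c a b x.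

(** Total symmetry of T makes the three terms of the Christoffel symbol equal up to sign, so just
    one survives. *)
Let christoffelE : \forall y \near x, forall k a b,
  christoffel g k a b y = 2^-1 * \sum_l invmx (g y) k l * T l a b y.
Proof.
apply: filterS dg => y dgy k a b; rewrite /christoffel; congr (_ * _).
apply: eq_bigr => l _; congr (_ * _).
have dE c' a' b' : partial c' (fun y => g y a' b') y = T c' a' b' y.
  by have := dgy c' a' b'; rewrite /partial => ?; exact: derive_val.
rewrite !dE [T b a l y]T_sym12 [T a b l y]T_sym23 [T a l b y]T_sym12.
by rewrite [T l a b y]T_sym12 [T a l b y]T_sym23 [T a b l y]T_sym12 addrK.
Qed.

Let partial_christoffel c k d b :
  partial c (christoffel g k d b) x =
  2^-1 * \sum_l (- (K *m Tm c *m K) k l * T l d b x + K k l * T4 c l d b).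
Proof.
rewrite /partial.
suff H : is_derive x (dir c) (christoffel g k d b)
    (2^-1 * \sum_l (- (K *m Tm c *m K) k l * T l d b x + K k l * T4 c l d b)).
  exact: derive_val.
apply: (@near_eq_is_derive _ _ _
    (fun y => 2^-1 * \sum_l invmx (g y) k l * T l d b y)).
  by apply: filterS christoffelE => y ->.
have dgx := nbhs_singleton dg.
have dK := @is_derive_invmx _ _ _ g (Tm c) x (dir c) g_unit.
have d1 : is_derive x (dir c) (fun y => \sum_l invmx (g y) k l * T l d b y)
    (\sum_l (- (K *m Tm c *m K) k l * T l d b x + K k l * T4 c l d b)).
  apply: is_derive_big => l; apply: is_derive_mul => //.
  have -> : - (K *m Tm c *m K) k l = (- (K *m Tm c *m K)) k l by rewrite [RHS]mxE.
  by apply: dK => i j; rewrite mxE; exact: dgx.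
by apply: is_derive_eq.
Qed.

(** Differentiating the inverse metric contributes - 1/2 K T_c K T_d, and the product of Christoffel
    symbols contributes + 1/4 K T_c K T_d; together - 1/4. The terms in [T4] are symmetric under the
    exchange of c and d and cancel. *)
Lemma riemann_hessian a b c d :
  riemann g x a b c d =
  - 4^-1 * \sum_p \sum_q K p q * (T a c p x * T b d q x - T a d p x * T b c q x).
Proof.
have gxu : g x \in unitmx := nbhs_singleton g_unit.
pose w d' : 'cV[R]_n.+1 := \col_l T l d' b x.
have subE (A B : 'cV[R]_n.+1) i : (A - B) i 0 = A i 0 - B i 0 by rewrite !mxE.
have scaleE z (A : 'cV[R]_n.+1) i : (z *: A) i 0 = z * A i 0 by rewrite mxE.
have upE k : riemann_up g x k b c d =
    (- 4^-1 *: (K *m (Tm c *m K *m w d - Tm d *m K *m w c))) k 0.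
  rewrite /riemann_up !partial_christoffel.
  have chE := nbhs_singleton christoffelE.
  have first_ c' d' : \sum_l (- (K *m Tm c' *m K) k l * T l d' b x + K k l * T4 c' l d' b)
      = - (K *m Tm c' *m K *m w d') k 0 + \sum_l K k l * T4 c' l d' b.
    rewrite big_split /=; congr (_ + _).
    by rewrite [in RHS]mxE -sumrN; apply: eq_bigr => l _; rewrite mulNr [w d' _ _]mxE.
  have quad c' d' : \sum_l (christoffel g k c' l x * christoffel g l d' b x)
      = 4^-1 * (K *m Tm c' *m K *m w d') k 0.
    have -> : (K *m Tm c' *m K *m w d') k 0 =
        \sum_l (K *m Tm c') k l * (K *m w d') l 0 by rewrite -mulmxA mxE.
    rewrite mulr_sumr; apply: eq_bigr => l _; rewrite !chE !mxE.
    have -> : \sum_j K k j * Tm c' j l = \sum_j K k j * T j c' l x.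
      by apply: eq_bigr => j _; rewrite mxE T_sym12.
    have -> : \sum_j K l j * w d' j 0 = \sum_j K l j * T j d' b x.
      by apply: eq_bigr => j _; rewrite mxE.
    by field.
  rewrite !first_ sumrB !quad.
  have -> : \sum_l K k l * T4 d l c b = \sum_l K k l * T4 c l d b.
    by apply: eq_bigr => l _; rewrite T4_sym.
  rewrite scaleE mulmxBr subE !mulmxA.
  set A := (K *m Tm c *m K *m w d) k 0; set B := (K *m Tm d *m K *m w c) k 0.
  by field.
rewrite /riemann.
under eq_bigr do rewrite upE.
have -> : \sum_k g x a k * (- 4^-1 *: (K *m (Tm c *m K *m w d - Tm d *m K *m w c))) k 0
   = (g x *m (- 4^-1 *: (K *m (Tm c *m K *m w d - Tm d *m K *m w c)))) a 0 by rewrite [RHS]mxE.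
rewrite -scalemxAr mulmxA mulmxV// mul1mx scaleE subE; congr (_ * _).
rewrite -!mulmxA !mxE -sumrB; apply: eq_bigr => p _.
rewrite !mxE !mulr_sumr -sumrB; apply: eq_bigr => q _; rewrite !mxE.
rewrite [T c a p x]T_sym12 [T d a p x]T_sym12.
rewrite [T q d b x]T_sym23 [T q b d x]T_sym12 [T b q d x]T_sym23.
rewrite [T q c b x]T_sym23 [T q b c x]T_sym12 [T b q c x]T_sym23.
by ring.
Qed.

End HessianCurvature.

(** * Asymptotics in a moving frame *)

Section TensorNormInFrame.
Context {R : realType} {n : nat}.
Local Notation J := 'I_n.+1.
Implicit Types (M N C : 'M[R]_n.+1).

Definition contract M (K : J -> J -> R) : R := \sum_a \sum_b M a b * K a b.

Lemma contract_swap M N (K : J -> J -> J -> J -> R) :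
  contract M (fun a a' => contract N (fun b b' => K a a' b b')) =
  contract N (fun b b' => contract M (fun a a' => K a a' b b')).
Proof.
rewrite /contract; under eq_bigr do under eq_bigr do rewrite mulr_sumr.
under eq_bigr do under eq_bigr do under eq_bigr do rewrite mulr_sumr.
under eq_bigr do rewrite exchange_big /=.
rewrite exchange_big /=.
under [in RHS]eq_bigr do under eq_bigr do rewrite mulr_sumr.
under [in RHS]eq_bigr do under eq_bigr do under eq_bigr do rewrite mulr_sumr.
apply: eq_bigr => b _.
under eq_bigr do rewrite exchange_big /=.
rewrite exchange_big /=; apply: eq_bigr => b' _.
apply: eq_bigr => a _; apply: eq_bigr => a' _.
by rewrite mulrCA.
Qed.

Lemma eq_contract M (K K' : J -> J -> R) :
  (forall a b, K a b = K' a b) -> contract M K = contract M K'.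
Proof.
by move=> KK'; apply: eq_bigr => a _; apply: eq_bigr => b _; rewrite KK'.
Qed.

(** Change of frame for one contracted pair of indices: covectors transform by C, the contravariant
    form M becomes C M C^T. *)
Lemma contract_pull M C (f f' F F' : J -> R) :
  (forall a, f a = \sum_i C i a * F i) -> (forall a, f' a = \sum_i C i a * F' i) ->
  contract M (fun a a' => f a * f' a') =
  contract (C *m M *m C^T) (fun i i' => F i * F' i').
Proof.
move=> fF fF'; rewrite /contract.
transitivity (\sum_a \sum_b \sum_i \sum_j C i a * M a b * C j b * (F i * F' j)).
  apply: eq_bigr => a _; apply: eq_bigr => b _; rewrite fF fF' mulr_suml mulr_sumr.
  apply: eq_bigr => i _; rewrite !mulr_sumr; apply: eq_bigr => j _; ring.
under eq_bigr do rewrite exchange_big /=.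
rewrite exchange_big /=; apply: eq_bigr => i _.
under eq_bigr do rewrite exchange_big /=.
rewrite exchange_big /=; apply: eq_bigr => j _.
rewrite !mxE mulr_suml exchange_big /=; apply: eq_bigr => b _.
rewrite !mxE !mulr_suml; apply: eq_bigr => a _; ring.
Qed.

(** The last index is contracted outermost, so that the innermost contraction meets the outermost
    sum of [pull4]. *)
Definition sqnorm4 N (s : J -> J -> J -> J -> R) : R :=
  contract N (fun d d' => contract N (fun c c' => contract N (fun b b' =>
    contract N (fun a a' => s a b c d * s a' b' c' d')))).

Lemma contract_rev M (K : J -> J -> J -> J -> J -> J -> J -> J -> R) :
  contract M (fun d d' => contract M (fun c c' => contract M (fun b b' =>
    contract M (fun a a' => K a a' b b' c c' d d')))) =
  contract M (fun a a' => contract M (fun b b' => contract M (fun c c' =>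
    contract M (fun d d' => K a a' b b' c c' d d')))).
Proof.
apply: esym.
transitivity (contract M (fun c c' => contract M (fun d d' => contract M (fun a a' =>
  contract M (fun b b' => K a a' b b' c c' d d'))))).
  transitivity (contract M (fun a a' => contract M (fun c c' => contract M (fun b b' =>
    contract M (fun d d' => K a a' b b' c c' d d'))))).
    by apply: eq_contract => a a'; rewrite contract_swap.
  rewrite contract_swap; apply: eq_contract => c c'.
  transitivity (contract M (fun a a' => contract M (fun d d' =>
    contract M (fun b b' => K a a' b b' c c' d d')))).
    by apply: eq_contract => a a'; rewrite contract_swap.
  by rewrite contract_swap.
rewrite contract_swap; apply: eq_contract => d d'; apply: eq_contract => c c'.
by rewrite contract_swap.
Qed.

Lemma tensor4_normE (g : 'rV[R]_n.+1 -> 'M[R]_n.+1) (s : tensor4_field) x :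
  tensor4_norm g s x = Num.sqrt (sqnorm4 (invmx (g x)) (s x)).
Proof.
rewrite /tensor4_norm; congr Num.sqrt; set M := invmx (g x).
have swap3 (X : J -> J -> J -> J -> R) :
    \sum_b \sum_c \sum_d \sum_a' X b c d a' = \sum_a' \sum_b \sum_c \sum_d X b c d a'.
  under eq_bigr do under eq_bigr do rewrite exchange_big /=.
  by under eq_bigr do rewrite exchange_big /=; rewrite exchange_big.
have swap2 (X : J -> J -> J -> R) :
    \sum_c \sum_d \sum_a' X c d a' = \sum_a' \sum_c \sum_d X c d a'.
  by under eq_bigr do rewrite exchange_big /=; rewrite exchange_big.
transitivity (contract M (fun a a' => contract M (fun b b' => contract M (fun c c' =>
    contract M (fun d d' => s x a b c d * s x a' b' c' d'))))); last first.
  exact: esym (contract_rev M (fun a a' b b' c c' d d' => s x a b c d * s x a' b' c' d')).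
rewrite /contract; apply: eq_bigr => a _; rewrite swap3; apply: eq_bigr => a' _.
rewrite mulr_sumr; apply: eq_bigr => b _; rewrite swap2 mulr_sumr.
apply: eq_bigr => b' _; rewrite !mulr_sumr; apply: eq_bigr => c _.
rewrite exchange_big /= !mulr_sumr; apply: eq_bigr => c' _.
rewrite !mulr_sumr; apply: eq_bigr => d _; rewrite !mulr_sumr.
by apply: eq_bigr => d' _; ring.
Qed.

Definition pull4 C (s : J -> J -> J -> J -> R) (a b c d : J) : R :=
  \sum_i C i a * \sum_j C j b * \sum_k C k c * \sum_l C l d * s i j k l.

(** One index at a time: the innermost contraction is transformed by [contract_pull] and moved
    outwards, which exposes the next index. *)
Lemma sqnorm4_pull M C (s : J -> J -> J -> J -> R) :
  sqnorm4 M (pull4 C s) = sqnorm4 (C *m M *m C^T) s.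
Proof.
set N := C *m M *m C^T; rewrite /sqnorm4.
pose s3 i j k d := \sum_l C l d * s i j k l.
pose s2 i j c d := \sum_k C k c * s3 i j k d.
pose s1 i b c d := \sum_j C j b * s2 i j c d.
transitivity (contract M (fun d d' => contract M (fun c c' => contract M (fun b b' =>
    contract N (fun a a' => s1 a b c d * s1 a' b' c' d'))))).
  by do 3 apply: eq_contract => ? ?; exact: contract_pull.
transitivity (contract M (fun d d' => contract M (fun c c' => contract N (fun a a' =>
    contract N (fun b b' => s2 a b c d * s2 a' b' c' d'))))).
  do 2 apply: eq_contract => ? ?; rewrite contract_swap; apply: eq_contract => ? ?.
  exact: contract_pull.
transitivity (contract M (fun d d' => contract N (fun a a' => contract N (fun b b' =>
    contract N (fun c c' => s3 a b c d * s3 a' b' c' d'))))).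
  apply: eq_contract => ? ?; rewrite contract_swap; apply: eq_contract => ? ?.
  rewrite contract_swap; apply: eq_contract => ? ?; exact: contract_pull.
transitivity (contract N (fun a a' => contract N (fun b b' => contract N (fun c c' =>
    contract N (fun d d' => s a b c d * s a' b' c' d'))))).
  rewrite contract_swap; apply: eq_contract => ? ?.
  rewrite contract_swap; apply: eq_contract => ? ?.
  rewrite contract_swap; apply: eq_contract => ? ?; exact: contract_pull.
exact: esym (contract_rev N (fun a a' b b' c c' d d' => s a b c d * s a' b' c' d')).
Qed.

Local Open Scope classical_set_scope.

Lemma cvg_sqnorm4 (T : Type) (F : set_system T) (FF : Filter F)
    (N : T -> 'M[R]_n.+1) (L : 'M[R]_n.+1) (s : T -> J -> J -> J -> J -> R) :
  (forall i j, N x i j @[x --> F] --> L i j) ->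
  (forall a b c d, s x a b c d @[x --> F] --> (0 : R)) ->
  sqnorm4 (N x) (s x) @[x --> F] --> (0 : R).
Proof.
move=> NL s0.
have cvg_contract (K : T -> J -> J -> R) :
    (forall a b, K x a b @[x --> F] --> (0 : R)) ->
    contract (N x) (K x) @[x --> F] --> (0 : R).
  move=> K0; have -> : (0 : R) = \sum_(a : J) \sum_(b : J) L a b * 0.
    by rewrite big1// => a _; rewrite big1// => b _; rewrite mulr0.
  by do 2 (apply: cvg_bigsum => ?); apply: cvgM.
rewrite /sqnorm4; apply: (cvg_contract) => d d'; apply: (cvg_contract) => c c'.
apply: (cvg_contract) => b b'; apply: (cvg_contract) => a a'.
by rewrite -(mulr0 0); apply: cvgM; exact: s0.
Qed.

End TensorNormInFrame.

(** * The derivatives as polynomials in eta, lam and Q *)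

Section HessianPolynomials.
Context {R : realType} {J : Type}.
Variables (eta lam : J -> R) (Q : J -> J -> R).
Hypothesis QC : forall a b, Q a b = Q b a.

(** The formulas for the derivatives of the potential over an arbitrary index type: they are
    evaluated on tangent vectors, where they are multilinear, and on frame indices. *)
Definition tauP a := 2 * lam a - eta a.
Definition BP a b := 2 * Q a b - 4 * lam a * lam b + eta a * eta b.
Definition DBP c a b :=
  - 4 * (lam c * Q a b + lam a * Q c b + lam b * Q c a)
  + 16 * lam c * lam a * lam b - 2 * eta c * eta a * eta b.
Definition hessP p1 p2 a b :=
  3 / 2 * eta a * eta b + p2 * tauP a * tauP b + p1 * BP a b.
Definition cubicP p1 p2 p3 c a b := - 3 * eta c * eta a * eta b
  + p3 * tauP c * tauP a * tauP b
  + p2 * (tauP c * BP a b + tauP a * BP c b + tauP b * BP c a)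
  + p1 * DBP c a b.
(** Half the Hessian of [spin] divided by [spin]; equivalently |domega|^2 / |omega|^2. *)
Definition KP a b := Q a b - lam a * eta b - eta a * lam b + eta a * eta b.

(* As the spin grows, the coefficients p1, p2, p3 share the divergent part [w]; it
   multiplies [KP] only, which in the frame below decays like [1 / w]. *)
Lemma hessP_split w k1 k2 a b :
  hessP (w - 3 / 2 + k1) (w + k2) a b =
  hessP (k1 - 3 / 2) k2 a b + 2 * w * KP a b.
Proof. by rewrite /hessP /KP /BP /tauP; field. Qed.

Lemma cubicP_split w k1 k2 k3 c a b :
  cubicP (w - 3 / 2 + k1) (w + k2) (w + k3) c a b =
  cubicP (k1 - 3 / 2) k2 k3 c a b
  - 2 * w * (eta c * KP a b + eta a * KP c b + eta b * KP c a).
Proof.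
by rewrite /cubicP /KP /DBP /BP /tauP; field.
Qed.

Lemma hessPC p1 p2 a b : hessP p1 p2 a b = hessP p1 p2 b a.
Proof. by rewrite /hessP /BP [Q a b]QC; ring. Qed.

Lemma cubicP_sym12 p1 p2 p3 c a b : cubicP p1 p2 p3 c a b = cubicP p1 p2 p3 a c b.
Proof. by rewrite /cubicP /DBP /BP [Q c a]QC [Q c b]QC; ring. Qed.

Lemma cubicP_sym23 p1 p2 p3 c a b : cubicP p1 p2 p3 c a b = cubicP p1 p2 p3 c b a.
Proof. by rewrite /cubicP /DBP /BP [Q a b]QC; ring. Qed.

End HessianPolynomials.

(** * The moving frame and its components *)

Section Frame.
Context {R : realType} (m rad : R).
Hypotheses (m_gt0 : 0 < m) (rad_gt0 : 0 < rad).
Implicit Types (u v w : 'rV[R]_4).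
Local Notation al := (half_inertia m rad).

Definition linear_form (f : 'rV[R]_4 -> R) :=
  forall (k : R) u v, f (k *: u + v) = k * f u + f v.

Lemma linear_form_sum f (c : 'I_4 -> R) (e_ : 'I_4 -> 'rV[R]_4) : linear_form f ->
  f (\sum_i c i *: e_ i) = \sum_i c i * f (e_ i).
Proof.
move=> lf.
have f0 : f 0 = 0 by have := lf (-1) 0 0; rewrite scaler0 addr0 mulN1r addNr.
apply: (big_ind2 (fun u s => f u = s)) => // [u1 s1 u2 s2 <- <-|i _].
  by have := lf 1 u1 u2; rewrite scale1r mul1r.
by have := lf (c i) (e_ i) 0; rewrite !addr0 f0 addr0.
Qed.

Variable x : 'rV[R]_4.
Hypothesis x_dom : chart_dom x.

Let b0 : beta_of x != 0. Proof. by move/andP: x_dom => [b0 _]; rewrite gt_eqF. Qed.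
Let r0 : rsq x != 0. Proof. by move/andP: x_dom => [_ r0]; rewrite gt_eqF. Qed.

Definition etav u : R := u 0 ord0 / beta_of x.
Definition lamv u : R := (\sum_(i < 3) u 0 (lift ord0 i) * x 0 (lift ord0 i)) / rsq x.
Definition Qv u v : R := (\sum_(i < 3) u 0 (lift ord0 i) * v 0 (lift ord0 i)) / rsq x.

Lemma QvC u v : Qv u v = Qv v u.
Proof. by rewrite /Qv; congr (_ / _); apply: eq_bigr => i _; rewrite mulrC. Qed.

Lemma linear_etav : linear_form etav.
Proof. by move=> k u v; rewrite /etav !mxE; ring. Qed.

Lemma linear_lamv : linear_form lamv.
Proof.
move=> k u v; rewrite /lamv mulrA -mulrDl; congr (_ / _).
by rewrite mulr_sumr -big_split; apply: eq_bigr => i _; rewrite !mxE /=; ring.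
Qed.

Lemma linear_Qv w : linear_form (fun u => Qv u w).
Proof.
move=> k u v; rewrite /Qv mulrA -mulrDl; congr (_ / _).
by rewrite mulr_sumr -big_split; apply: eq_bigr => i _; rewrite !mxE /=; ring.
Qed.

Lemma linear_hessP p1 p2 w : linear_form (fun u => hessP etav lamv Qv p1 p2 u w).
Proof.
move=> k u v.
by rewrite /hessP /BP /tauP linear_etav linear_lamv linear_Qv; ring.
Qed.

Lemma linear_cubicP p1 p2 p3 w w' :
  linear_form (fun u => cubicP etav lamv Qv p1 p2 p3 u w w').
Proof.
move=> k u v.
rewrite /cubicP /DBP /BP /tauP linear_etav linear_lamv !(linear_Qv _ k u v) ; ring.
Qed.

Local Notation dir a := (delta_mx 0 a : 'rV[R]_4).

Lemma sum_dir (F : 'I_4 -> R) a :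
  \sum_(i < 3) (dir a) 0 (lift ord0 i) * F (lift ord0 i) = (a != ord0)%:R * F a.
Proof.
case: (unliftP ord0 a) => [j ->|->].
  rewrite [lift ord0 j == ord0]eq_sym neq_lift mul1r.
  rewrite (eq_bigr (fun i => if i == j then F (lift ord0 i) else 0)).
    by rewrite -big_mkcond /= big_pred1_eq.
  by move=> i _; rewrite mxE eqxx /= (inj_eq lift_inj); case: eqP => _ /=; ring.
rewrite eqxx mul0r big1// => i _.
by rewrite mxE eqxx /= mul0r.
Qed.

Lemma etav_dir a : etav (dir a) = eta a x.
Proof. by rewrite /etav mxE eqxx /= eq_sym. Qed.

Lemma lamv_dir a : lamv (dir a) = lam a x.
Proof. by rewrite /lamv (sum_dir (fun i => x 0 i)). Qed.

Lemma Qv_dir a b : Qv (dir a) (dir b) = Qf a b x.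
Proof.
rewrite /Qv (sum_dir (fun i => dir b 0 i)) /Qf mxE eqxx /=.
by case: eqP => _; case: eqP => _ /=; rewrite ?mulr0 ?mul0r ?mulr1.
Qed.

Lemma hessf_dir a b : hessf m rad a b x =
  hessP etav lamv Qv (phi1 m rad (spin x)) (phi2 m rad (spin x)) (dir a) (dir b).
Proof.
by rewrite /hessP /BP /tauP !etav_dir !lamv_dir !Qv_dir.
Qed.

Lemma cubicf_dir c a b : cubicf m rad c a b x =
  cubicP etav lamv Qv (phi1 m rad (spin x)) (phi2 m rad (spin x))
    (phi3 m rad (spin x)) (dir c) (dir a) (dir b).
Proof.
by rewrite /cubicP /DBP /BP /tauP !etav_dir !lamv_dir !Qv_dir.
Qed.

Definition fscale : R := Num.sqrt (2 * al / beta_of x).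

Lemma fscale_gt0 : 0 < fscale.
Proof.
move/andP: x_dom => [b _].
by rewrite sqrtr_gt0 divr_gt0// mulr_gt0// half_inertia_gt0.
Qed.

Lemma fscale_sqr : fscale ^+ 2 = 2 * al / beta_of x.
Proof.
move/andP: x_dom => [b _].
by rewrite sqr_sqrtr// divr_ge0 ?mulr_ge0 ?ltW// half_inertia_gt0.
Qed.

Let k0 : fscale != 0. Proof. by rewrite gt_eqF// fscale_gt0. Qed.

(* The frame beta d/dbeta + r d/dr, d/dr_i / fscale and its dual coframe. *)
Definition frame (A : 'I_4) : 'rV[R]_4 :=
  if A == ord0 then x else fscale^-1 *: dir A.

Definition coframe : 'M[R]_4 := \matrix_(A, a)
  if A == ord0 then eta a x else fscale * ((a == A)%:R - x 0 A * eta a x).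

Lemma dir_frame a : dir a = \sum_A coframe A a *: frame A.
Proof.
apply/rowP => b; rewrite summxE big_ord_recl [frame ord0]/frame eqxx !mxE eqxx /=.
rewrite (eq_bigr (fun i => dir b 0 (lift ord0 i) *
  ((a == lift ord0 i)%:R - x 0 (lift ord0 i) * eta a x))).
  rewrite (sum_dir (fun i => (a == i)%:R - x 0 i * eta a x)) [b == a]eq_sym.
  case: (eqVneq b ord0) => [->|_] /=; last by ring.
  by rewrite /eta mul0r addr0 -/(beta_of x) divfK.
move=> i _; rewrite /frame eq_sym (negbTE (neq_lift _ _)) !mxE eqxx /=.
rewrite [b == _]eq_sym.
by field.
Qed.

Lemma coframe_unit : coframe \in unitmx.
Proof.
have : (\matrix_(b, A) frame A 0 b) *m coframe = 1%:M.
  apply/matrixP => b a; rewrite mxE.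
  have := congr1 (fun u : 'rV[R]_4 => u 0 b) (dir_frame a).
  rewrite summxE !mxE eqxx /= => ->.
  by apply: eq_bigr => A _; rewrite !mxE mulrC.
by move=> /mulmx1_unit[].
Qed.

(** Expands each slot in the frame: the coordinate components of a multilinear form are the pullback
    of its frame components. *)
Lemma pull4_multilinear (V : 'rV[R]_4 -> 'rV[R]_4 -> 'rV[R]_4 -> 'rV[R]_4 -> R) :
  (forall v w z, linear_form (fun u => V u v w z)) ->
  (forall u w z, linear_form (fun v => V u v w z)) ->
  (forall u v z, linear_form (fun w => V u v w z)) ->
  (forall u v w, linear_form (fun z => V u v w z)) ->
  forall a b c d, V (dir a) (dir b) (dir c) (dir d) =
    pull4 coframe (fun i j k l => V (frame i) (frame j) (frame k) (frame l)) a b c d.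
Proof.
move=> l1 l2 l3 l4 a b c d.
rewrite {1}(dir_frame a) (linear_form_sum _ _ (l1 _ _ _)).
apply: eq_bigr => i _; congr (_ * _).
rewrite {1}(dir_frame b) (linear_form_sum _ _ (l2 _ _ _)).
apply: eq_bigr => j _; congr (_ * _).
rewrite {1}(dir_frame c) (linear_form_sum _ _ (l3 _ _ _)).
apply: eq_bigr => k _; congr (_ * _).
by rewrite {1}(dir_frame d) (linear_form_sum _ _ (l4 _ _ _)).
Qed.

Definition etaF (A : 'I_4) : R := (A == ord0)%:R.
Definition PF (A B : 'I_4) : R := ((A == B) && (A != ord0))%:R.
(** The value of [lam] on the rescaled fields. Together with [epsF], the value of [Q] on a rescaled
    field paired with itself, it is what vanishes in the limit. *)
Definition nuF (A : 'I_4) : R := (A != ord0)%:R * x 0 A / (fscale * rsq x).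
Definition lamF (A : 'I_4) : R := etaF A + nuF A.
Definition epsF : R := (2 * al * spin x)^-1.
Definition QF (A B : 'I_4) : R :=
  etaF A * etaF B + etaF A * nuF B + nuF A * etaF B + epsF * PF A B.

Lemma epsFE : epsF = (fscale ^+ 2 * rsq x)^-1.
Proof.
by rewrite /epsF fscale_sqr /spin; field; rewrite b0 r0 gt_eqF// half_inertia_gt0.
Qed.

Lemma etav_frame A : etav (frame A) = etaF A.
Proof.
rewrite /frame /etaF; case: eqP => [_|/eqP A0]; first by rewrite /etav divff.
by rewrite /etav !mxE eqxx /= eq_sym (negbTE A0) mulr0 mul0r.
Qed.

Lemma sum_frame (F : 'I_4 -> R) A :
  \sum_(i < 3) frame A 0 (lift ord0 i) * F (lift ord0 i) =
  if A == ord0 then \sum_(i < 3) x 0 (lift ord0 i) * F (lift ord0 i)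
  else F A / fscale.
Proof.
rewrite /frame; case: ifPn => // A0.
transitivity (fscale^-1 * \sum_(i < 3) (dir A) 0 (lift ord0 i) * F (lift ord0 i)).
  by rewrite mulr_sumr; apply: eq_bigr => i _; rewrite mxE mulrA.
by rewrite sum_dir A0 mul1r mulrC.
Qed.

Lemma sum_sqr_rsq : \sum_(i < 3) x 0 (lift ord0 i) * x 0 (lift ord0 i) = rsq x.
Proof. by apply: eq_bigr => i _; rewrite expr2. Qed.

Lemma lamv_frame A : lamv (frame A) = lamF A.
Proof.
rewrite /lamv (sum_frame (fun i => x 0 i)) sum_sqr_rsq /lamF /etaF /nuF.
case: eqP => _ /=; first by rewrite divff// !mul0r addr0.
by field; rewrite k0 r0.
Qed.

Lemma Qv_frame A B : Qv (frame A) (frame B) = QF A B.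
Proof.
rewrite /Qv (sum_frame (fun i => frame B 0 i)) /QF /etaF /nuF /PF epsFE.
have E : \sum_(i < 3) x 0 (lift ord0 i) * frame B 0 (lift ord0 i) =
    if B == ord0 then rsq x else x 0 B / fscale.
  under eq_bigr do rewrite mulrC.
  by rewrite (sum_frame (fun i => x 0 i)) sum_sqr_rsq.
case: (eqVneq A ord0) => [->|A0] /=.
  rewrite E eq_sym; case: (eqVneq B ord0) => [_|B0] /=.
    by rewrite divff//; ring.
  by field; rewrite k0 r0.
rewrite /frame; case: (eqVneq B ord0) => [->|B0] /=.
  by rewrite (negbTE A0) /=; field; rewrite k0 r0.
by rewrite !mxE eqxx /= andbT; field; rewrite k0 r0.
Qed.

(** The terms in [nuF] cancel, leaving [epsF] times [PF], and [epsF] is the inverse of 2 a s: the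
    divergent factor is compensated exactly. *)
Lemma KP_frame A B :
  2 * (al * spin x) * KP etav lamv Qv (frame A) (frame B) = PF A B.
Proof.
have w0 : al * spin x != 0.
  by rewrite mulf_neq0 ?gt_eqF ?half_inertia_gt0 ?spin_gt0.
rewrite /KP !etav_frame !lamv_frame Qv_frame /QF /lamF /epsF mulrA.
have -> : etaF A * etaF B + etaF A * nuF B + nuF A * etaF B +
  (2 * al * spin x)^-1 * PF A B - (etaF A + nuF A) * etaF B
  - etaF A * (etaF B + nuF B) + etaF A * etaF B =
  (2 * al * spin x)^-1 * PF A B by ring.
rewrite mulVKf// -mulrA mulf_neq0 ?pnatr_eq0//.
Qed.

(** A part with bounded coefficients plus [PF], the whole contribution of the divergent term;
    [cubicF] has the same structure. *)
Definition hessF (A B : 'I_4) : R :=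
  hessP etaF lamF QF (kap (al * spin x) - 3 / 2) (kap2 (al * spin x)) A B + PF A B.

Definition cubicF (G A B : 'I_4) : R :=
  cubicP etaF lamF QF (kap (al * spin x) - 3 / 2) (kap2 (al * spin x))
    (kap3 (al * spin x)) G A B
  - (etaF G * PF A B + etaF A * PF G B + etaF B * PF G A).

Lemma hess_frame A B :
  hessP etav lamv Qv (phi1 m rad (spin x)) (phi2 m rad (spin x)) (frame A) (frame B)
  = hessF A B.
Proof.
rewrite /phi1 /phi2 hessP_split KP_frame /hessF; congr (_ + _).
by rewrite /hessP /BP /tauP !etav_frame !lamv_frame Qv_frame.
Qed.

Lemma cubic_frame G A B :
  cubicP etav lamv Qv (phi1 m rad (spin x)) (phi2 m rad (spin x))
    (phi3 m rad (spin x)) (frame G) (frame A) (frame B)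
  = cubicF G A B.
Proof.
rewrite /phi1 /phi2 /phi3 cubicP_split /cubicF -!KP_frame !etav_frame; congr (_ - _).
  by rewrite /cubicP /DBP /BP /tauP !etav_frame !lamv_frame !Qv_frame.
by ring.
Qed.

End Frame.

(** * Limits of the polynomials *)

Section PolynomialLimits.
Context {R : realType} {T J : Type} (F : set_system T) {FF : Filter F}.
Local Open Scope classical_set_scope.
Variables (eta : J -> R) (lam : T -> J -> R) (Q : T -> J -> J -> R).
Variables (p1 p2 p3 : T -> R) (laml : J -> R) (Ql : J -> J -> R) (l1 l2 l3 : R).
Hypothesis lam_cvg : forall a, lam x a @[x --> F] --> laml a.
Hypothesis Q_cvg : forall a b, Q x a b @[x --> F] --> Ql a b.
Hypothesis p1_cvg : p1 x @[x --> F] --> l1.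
Hypothesis p2_cvg : p2 x @[x --> F] --> l2.
Hypothesis p3_cvg : p3 x @[x --> F] --> l3.

Lemma cvg_tauP a : tauP eta (lam x) a @[x --> F] --> tauP eta laml a.
Proof.
apply: cvgB; last exact: cvg_cst.
by apply: cvgM; [exact: cvg_cst|exact: lam_cvg].
Qed.

Lemma cvg_BP a b : BP eta (lam x) (Q x) a b @[x --> F] --> BP eta laml Ql a b.
Proof.
apply: cvgD; last exact: cvg_cst.
apply: cvgB; first by apply: cvgM; [exact: cvg_cst|exact: Q_cvg].
apply: cvgM; last exact: lam_cvg.
by apply: cvgM; [exact: cvg_cst|exact: lam_cvg].
Qed.

Lemma cvg_DBP c a b : DBP eta (lam x) (Q x) c a b @[x --> F] --> DBP eta laml Ql c a b.
Proof.
have lamQ i j k : lam x i * Q x j k @[x --> F] --> laml i * Ql j k.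
  by apply: cvgM; [exact: lam_cvg|exact: Q_cvg].
apply: cvgB; last exact: cvg_cst.
apply: cvgD.
  apply: cvgM; first exact: cvg_cst.
  by apply: cvgD; [apply: cvgD; exact: lamQ|exact: lamQ].
apply: cvgM; last exact: lam_cvg.
apply: cvgM; last exact: lam_cvg.
by apply: cvgM; [exact: cvg_cst|exact: lam_cvg].
Qed.

Lemma cvg_hessP a b :
  hessP eta (lam x) (Q x) (p1 x) (p2 x) a b @[x --> F] --> hessP eta laml Ql l1 l2 a b.
Proof.
have ct := cvg_tauP; have cb := cvg_BP.
apply: cvgD; last by apply: cvgM; [exact: p1_cvg|exact: cb].
apply: cvgD; first exact: cvg_cst.
by apply: cvgM; [apply: cvgM; [exact: p2_cvg|exact: ct]|exact: ct].
Qed.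

Lemma cvg_cubicP c a b :
  cubicP eta (lam x) (Q x) (p1 x) (p2 x) (p3 x) c a b @[x --> F] -->
  cubicP eta laml Ql l1 l2 l3 c a b.
Proof.
have ct := cvg_tauP; have cb := cvg_BP; have cd := cvg_DBP.
apply: cvgD; last by apply: cvgM; [exact: p1_cvg|exact: cd].
apply: cvgD.
  apply: cvgD; first exact: cvg_cst.
  apply: cvgM; last exact: ct.
  by apply: cvgM; [apply: cvgM; [exact: p3_cvg|exact: ct]|exact: ct].
apply: cvgM; first exact: p2_cvg.
have ctb i j k : tauP eta (lam x) i * BP eta (lam x) (Q x) j k @[x --> F] -->
    tauP eta laml i * BP eta laml Ql j k.
  by apply: cvgM; [exact: ct|exact: cb].
by apply: cvgD; [apply: cvgD; exact: ctb|exact: ctb].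
Qed.

End PolynomialLimits.

(** * Limits of the metric and of its derivative in the frame *)

Section FrameLimits.
Context {R : realType} (m rad : R).
Hypotheses (m_gt0 : 0 < m) (rad_gt0 : 0 < rad).
Local Open Scope classical_set_scope.
Local Notation al := (half_inertia m rad).
Implicit Types (x : 'rV[R]_4) (A B G D : 'I_4).

Let al_gt0 : 0 < al. Proof. exact: half_inertia_gt0. Qed.

(* The filter "beta omega^2 -> +oo, uniformly in the other variables". *)
Definition spinning : set_system 'rV[R]_4 :=
  [set S | exists M, forall x, chart_dom x -> M < spin x -> S x].

Global Instance spinning_filter : Filter spinning.
Proof.
split.
- by exists 0.
- move=> S S' [M HM] [M' HM']; exists (Num.max M M') => x xD.
  by rewrite gt_max => /andP[? ?]; split; [exact: HM|exact: HM'].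
- by move=> S S' SS' [M HM]; exists M => x xD Mx; exact/SS'/HM.
Qed.

Lemma cvg_al_spin : al * spin x @[x --> spinning] --> +oo.
Proof.
apply/cvgryPgt => A; exists (A / al) => x xD /=.
by rewrite ltr_pdivrMr// mulrC.
Qed.

Lemma cvg_epsF : epsF m rad x @[x --> spinning] --> (0 : R).
Proof.
apply/cvgrPdist_lt => /= e e0; exists ((2 * al * e)^-1) => x xD /= sx.
have s0 := spin_gt0 xD.
have as0 : 0 < 2 * al * spin x by rewrite mulr_gt0// mulr_gt0.
rewrite sub0r normrN /epsF ger0_norm; last by rewrite invr_ge0 ltW.
have -> : e = (e^-1)^-1 by rewrite invrK.
rewrite ltf_pV2 ?posrE ?invr_gt0//.
move: sx; rewrite -(ltr_pM2l (_ : 0 < 2 * al)) ?mulr_gt0//.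
by apply: le_lt_trans; rewrite invfM mulrA mulfV ?mul1r// gt_eqF ?mulr_gt0.
Qed.

(** r_i^2 <= |r|^2, and [epsF] = 1 / (fscale^2 |r|^2). The bound depends on the point through [spin]
    alone, which yields uniformity. *)
Lemma nuF_sqr_le x A : chart_dom x -> nuF m rad x A ^+ 2 <= epsF m rad x.
Proof.
move=> xD; have k0 := fscale_gt0 m_gt0 rad_gt0 xD; move/andP: (xD) => [b0 r0].
rewrite (epsFE m_gt0 rad_gt0 xD) /nuF.
have sqA : (A != ord0)%:R * x 0 A ^+ 2 <= rsq x.
  case: (unliftP ord0 A) => [j ->|->]; last by rewrite eqxx mul0r ltW.
  rewrite [lift ord0 j == ord0]eq_sym neq_lift mul1r /rsq (bigD1 j)//= lerDl.
  by apply: sumr_ge0 => i _; rewrite sqr_ge0.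
have -> : ((A != ord0)%:R * x 0 A / (fscale m rad x * rsq x)) ^+ 2 =
  (A != ord0)%:R * x 0 A ^+ 2 / rsq x * (fscale m rad x ^+ 2 * rsq x)^-1.
  by case: (A != ord0) => /=; field; rewrite !gt_eqF.
rewrite -[leRHS]mul1r ler_pM2r ?invr_gt0 ?mulr_gt0 ?exprn_gt0//.
by rewrite ler_pdivrMr// mul1r.
Qed.

Lemma cvg_nuF A : nuF m rad x A @[x --> spinning] --> (0 : R).
Proof.
apply/cvgrPdist_lt => /= e e0.
have /cvgrPdist_lt/(_ (e ^+ 2) (exprn_gt0 _ e0)) [M HM] := cvg_epsF.
exists M => x xD /(HM x xD) /=; rewrite !sub0r !normrN => epsx.
rewrite -ltr_sqr ?nnegrE ?(ltW e0)// real_normK ?num_real//.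
exact: le_lt_trans (nuF_sqr_le _ xD) (le_lt_trans (ler_norm _) epsx).
Qed.

Lemma cvg_lamF A : lamF m rad x A @[x --> spinning] --> (etaF A : R).
Proof.
rewrite -[X in _ --> X]addr0; apply: cvgD; [exact: cvg_cst|exact: cvg_nuF].
Qed.

Lemma cvg_QF A B : QF m rad x A B @[x --> spinning] --> (etaF A * etaF B : R).
Proof.
have -> : etaF A * etaF B = etaF A * etaF B + etaF A * 0 + 0 * etaF B + 0 * PF A B :> R.
  by ring.
apply: cvgD; last by apply: cvgM; [exact: cvg_epsF|exact: cvg_cst].
apply: cvgD; last by apply: cvgM; [exact: cvg_nuF|exact: cvg_cst].
apply: cvgD; first exact: cvg_cst.
by apply: cvgM; [exact: cvg_cst|exact: cvg_nuF].
Qed.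

Lemma cvg_kap_spin : kap (al * spin x) @[x --> spinning] --> (0 : R).
Proof. exact: cvg_comp cvg_al_spin cvg_kap. Qed.

Lemma cvg_kap2_spin : kap2 (al * spin x) @[x --> spinning] --> (0 : R).
Proof. exact: cvg_comp cvg_al_spin cvg_kap2. Qed.

Lemma cvg_kap3_spin : kap3 (al * spin x) @[x --> spinning] --> (0 : R).
Proof. exact: cvg_comp cvg_al_spin cvg_kap3. Qed.

Definition hessL A B : R := 3 * etaF A * etaF B + PF A B.

Definition cubicL G A B : R := - 6 * etaF G * etaF A * etaF B
  - (etaF G * PF A B + etaF A * PF G B + etaF B * PF G A).

Lemma cvg_hessF A B : hessF m rad x A B @[x --> spinning] --> hessL A B.
Proof.
(* In the limit lam = eta and Q = eta eta, so tau = eta and B = - eta eta; with p1 = - 3/2 the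
   coefficient is 3/2 + 3/2 = 3. *)
have -> : hessL A B = hessP etaF etaF (fun A B => etaF A * etaF B) (0 - 3 / 2) 0 A B + PF A B.
  by rewrite /hessL /hessP /BP /tauP; field.
apply: cvgD; last exact: cvg_cst.
apply: cvg_hessP; [exact: cvg_lamF|exact: cvg_QF| |exact: cvg_kap2_spin].
by apply: cvgB; [exact: cvg_kap_spin|exact: cvg_cst].
Qed.

Lemma cvg_cubicF G A B : cubicF m rad x G A B @[x --> spinning] --> cubicL G A B.
Proof.
(* Here [DBP] tends to (- 12 + 16 - 2) eta eta eta, so the coefficient is - 3 - 3/2 * 2 = - 6. *)
have -> : cubicL G A B =
    cubicP etaF etaF (fun A B => etaF A * etaF B) (0 - 3 / 2) 0 0 G A B
    - (etaF G * PF A B + etaF A * PF G B + etaF B * PF G A).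
  by rewrite /cubicL /cubicP /DBP /BP /tauP; field.
apply: cvgB; last exact: cvg_cst.
apply: cvg_cubicP; [exact: cvg_lamF|exact: cvg_QF| |exact: cvg_kap2_spin|exact: cvg_kap3_spin].
by apply: cvgB; [exact: cvg_kap_spin|exact: cvg_cst].
Qed.

Definition hessLV A B : R := 3^-1 * etaF A * etaF B + PF A B.

Lemma hessL_mul : (\matrix_(A, B) hessL A B) *m (\matrix_(A, B) hessLV A B) = 1%:M.
Proof.
apply/matrixP => A B; rewrite !mxE !big_ord_recl big_ord0 !mxE.
rewrite /hessL /hessLV /etaF /PF.
by case: A => [[|[|[|[|//]]]] ?]; case: B => [[|[|[|[|//]]]] ?] /=; field.
Qed.

Lemma invmx_hessL : invmx (\matrix_(A, B) hessL A B) = \matrix_(A, B) hessLV A B.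
Proof.
have /mulmx1_unit[Lu _] := hessL_mul.
by rewrite -[RHS](mulKmx Lu) hessL_mul mulmx1.
Qed.

(** A finite check over all index values. The factor 1/3 becomes - 1/12 once multiplied by the - 1/4
    of the curvature formula. *)
Lemma contract_cubicL A B G D :
  contract (\matrix_(A, B) hessLV A B)
    (fun P Q => cubicL A G P * cubicL B D Q - cubicL A D P * cubicL B G Q)
  = 3^-1 * (hessL A G * hessL B D - hessL A D * hessL B G).
Proof.
rewrite /contract.
have E (F : 'I_4 -> 'I_4 -> R) : \sum_P \sum_Q (\matrix_(A, B) hessLV A B) P Q * F P Q =
    3^-1 * F ord0 ord0 + \sum_(i < 3) F (lift ord0 i) (lift ord0 i).
  rewrite !big_ord_recl !big_ord0 !mxE /hessLV /etaF /PF /=; ring.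
rewrite E !big_ord_recl big_ord0 /cubicL /hessL /etaF /PF.
case: A => [[|[|[|[|//]]]] ?]; case: B => [[|[|[|[|//]]]] ?];
case: G => [[|[|[|[|//]]]] ?]; case: D => [[|[|[|[|//]]]] ?] /=; by field.
Qed.

End FrameLimits.

Section LinearForms.
Context {R : realType} {n : nat}.
Implicit Types (f g : 'rV[R]_4 -> R).

Lemma linear_formB f g : linear_form f -> linear_form g ->
  linear_form (fun u => f u - g u).
Proof. by move=> lf lg k u v; rewrite lf lg; ring. Qed.

Lemma linear_formD f g : linear_form f -> linear_form g ->
  linear_form (fun u => f u + g u).
Proof. by move=> lf lg k u v; rewrite lf lg; ring. Qed.

Lemma linear_formZ (c : R) f : linear_form f -> linear_form (fun u => c * f u).
Proof. by move=> lf k u v; rewrite lf; ring. Qed.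

Lemma linear_formZr (c : R) f : linear_form f -> linear_form (fun u => f u * c).
Proof. by move=> lf k u v; rewrite lf; ring. Qed.

Lemma linear_form_bigsum (I : Type) (r : seq I) (F : I -> 'rV[R]_4 -> R) :
  (forall i, linear_form (F i)) -> linear_form (fun u => \sum_(i <- r) F i u).
Proof.
move=> lF k u v; rewrite mulr_sumr -big_split /=.
by apply: eq_bigr => i _; rewrite lF.
Qed.

Lemma linear_form_contract (N : 'M[R]_n.+1) (K : 'rV[R]_4 -> 'I_n.+1 -> 'I_n.+1 -> R) :
  (forall P Q, linear_form (fun u => K u P Q)) ->
  linear_form (fun u => contract N (K u)).
Proof.
move=> lK; apply: linear_form_bigsum => P; apply: linear_form_bigsum => Q.
exact/linear_formZ/lK.
Qed.

End LinearForms.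

(** * The curvature tensor in the frame *)

Section CurvatureInFrame.
Context {R : realType} (m rad : R) (e : 'I_3 -> 'M[R]_3).
Hypotheses (m_gt0 : 0 < m) (rad_gt0 : 0 < rad) (e_basis : so3_orthonormal_basis e).
Local Open Scope classical_set_scope.
Local Notation al := (half_inertia m rad).
Local Notation dir a := (delta_mx 0 a : 'rV[R]_4).
Local Notation metric := (gas_metric m rad e).
Implicit Types (u v w : 'rV[R]_4).

Definition hessM x : 'M[R]_4 := \matrix_(A, B) hessF m rad x A B.

Definition hessV x u v : R :=
  hessP (etav x) (lamv x) (Qv x) (phi1 m rad (spin x)) (phi2 m rad (spin x)) u v.

Definition cubicV x u v w : R :=
  cubicP (etav x) (lamv x) (Qv x) (phi1 m rad (spin x)) (phi2 m rad (spin x))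
    (phi3 m rad (spin x)) u v w.

(** The contracted pair is expanded in the frame while the four free slots take vectors, so the same
    expression serves coordinate and frame components. *)
Definition riemannV x u1 u2 u3 u4 : R :=
  - 4^-1 * contract (invmx (hessM x)) (fun P Q =>
    cubicV x u1 u3 (frame m rad x P) * cubicV x u2 u4 (frame m rad x Q)
    - cubicV x u1 u4 (frame m rad x P) * cubicV x u2 u3 (frame m rad x Q)).

Definition half_knV (h : 'rV[R]_4 -> 'rV[R]_4 -> R) u1 u2 u3 u4 : R :=
  h u1 u3 * h u2 u4 - h u1 u4 * h u2 u3.

Lemma linear_hessV1 x w : linear_form (fun u => hessV x u w).
Proof. exact: linear_hessP. Qed.

Lemma linear_hessV2 x w : linear_form (fun u => hessV x w u).
Proof. by move=> k u v; rewrite /hessV !(hessPC _ _ (QvC x) _ _ w) linear_hessP. Qed.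

Lemma linear_cubicV1 x v w : linear_form (fun u => cubicV x u v w).
Proof. exact: linear_cubicP. Qed.

Lemma linear_cubicV2 x v w : linear_form (fun u => cubicV x v u w).
Proof.
by move=> k u u'; rewrite /cubicV !(cubicP_sym12 _ _ (QvC x) _ _ _ v) linear_cubicP.
Qed.

Lemma linear_cubicV3 x v w : linear_form (fun u => cubicV x v w u).
Proof.
move=> k u u'; have := linear_cubicV2 x v w k u u'.
by rewrite /cubicV !(cubicP_sym23 _ _ (QvC x) _ _ _ v w).
Qed.

Lemma metric_dir x a b : chart_dom x -> metric x a b = hessV x (dir a) (dir b).
Proof. by move=> xD; rewrite gas_metricE// hessf_dir. Qed.

Lemma metric_frame x : chart_dom x ->
  metric x = (coframe m rad x)^T *m hessM x *m coframe m rad x.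
Proof.
move=> xD; apply/matrixP => a b; rewrite metric_dir//.
rewrite {1}(dir_frame m_gt0 rad_gt0 xD a) (linear_form_sum _ _ (linear_hessV1 _ _)).
rewrite -mulmxA mxE; apply: eq_bigr => A _; rewrite !mxE; congr (_ * _).
rewrite {1}(dir_frame m_gt0 rad_gt0 xD b) (linear_form_sum _ _ (linear_hessV2 _ _)).
apply: eq_bigr => B _; rewrite mulrC; congr (_ * _).
by rewrite mxE /hessV hess_frame.
Qed.

Lemma metric_unit x : chart_dom x -> hessM x \in unitmx -> metric x \in unitmx.
Proof.
move=> xD hu; rewrite metric_frame// !unitmx_mul unitmx_tr hu.
by rewrite (coframe_unit m_gt0 rad_gt0 xD).
Qed.

(** The inverse metric has the inverse Gram matrix as its components in the frame. *)
Lemma frame_invmx x : chart_dom x -> metric x \in unitmx ->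
  coframe m rad x *m invmx (metric x) *m (coframe m rad x)^T = invmx (hessM x).
Proof.
move=> xD gu; set C := coframe m rad x; set X := _ *m C^T.
have Cu : C^T \in unitmx by rewrite unitmx_tr coframe_unit.
have hX : hessM x *m X = 1%:M.
  apply: (can_inj (mulKmx Cu)); rewrite mulmx1 /X !mulmxA -metric_frame//.
  by rewrite mulmxV// mul1mx.
have [hu _] := mulmx1_unit hX.
by rewrite -[LHS](mulKmx hu) hX mulmx1.
Qed.

Lemma near_spin (x : 'rV[R]_4) M : chart_dom x -> M < spin x -> \forall y \near x, M < spin y.
Proof.
move=> xD Mx; move/andP: (xD) => [b0 r0].
have cr : rsq y @[y --> x] --> rsq x := @continuous_rsq R x.
have cb : beta_of y @[y --> x] --> beta_of x := @continuous_beta R x.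
have bn0 : beta_of x != 0 by rewrite gt_eqF.
have sx : spin y @[y --> x] --> spin x by apply: cvgM cr (cvgV bn0 cb).
exact: (cvgr_gt _ sx M Mx).
Qed.

(** Curvature differentiates the inverse metric, so invertibility is required around x; this holds
    because the region of large spin is open. *)
Lemma near_metric_unit : \forall x \near spinning, \forall y \near x, metric y \in unitmx.
Proof.
have hL i j : hessM x i j @[x --> spinning] --> (\matrix_(A, B) hessL A B : 'M[R]_4) i j.
  by rewrite mxE; under eq_fun do rewrite mxE; exact: cvg_hessF.
have [Lu _] := mulmx1_unit (@hessL_mul R).
have L0 : \det (\matrix_(A, B) hessL A B : 'M[R]_4) != 0 by rewrite -unitfE -unitmxE.
have [M HM] := cvgr_neq0 _ (cvg_det _ hL) L0.
exists M => x xD Mx /=.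
near=> y; apply: metric_unit; first by near: y; exact: near_chart_dom.
rewrite unitmxE unitfE; apply: HM; first by near: y; exact: near_chart_dom.
by near: y; exact: near_spin.
Unshelve. all: by end_near.
Qed.

Lemma riemann_dir x a b c d : chart_dom x ->
  (\forall y \near x, metric y \in unitmx) ->
  riemann metric x a b c d = riemannV x (dir a) (dir b) (dir c) (dir d).
Proof.
move=> xD gu; have gxu := nbhs_singleton gu.
have dg : \forall y \near x, forall c a b, is_derive y (dir c)
    (fun z => metric z a b) (cubicf m rad c a b y).
  near=> y; move=> c' a' b'; apply: is_derive_gas_metric => //.
  by near: y; exact: near_chart_dom.
have dT d' c' a' b' :
    is_derive x (dir d') (cubicf m rad c' a' b') (quarticf m rad d' c' a' b' x).
  exact: is_derive_cubicf.
have s12 c' a' b' y : cubicf m rad c' a' b' y = cubicf m rad a' c' b' y.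
  exact: cubicf_sym12.
have s23 c' a' b' y : cubicf m rad c' a' b' y = cubicf m rad c' b' a' y.
  exact: cubicf_sym23.
have s4 d' c' a' b' : quarticf m rad d' c' a' b' x = quarticf m rad a' c' d' b' x.
  exact: quarticf_sym13.
rewrite (@riemann_hessian R 3 metric x (cubicf m rad)
  (fun d c a b => quarticf m rad d c a b x) gu dg s12 s23 dT s4).
rewrite /riemannV; congr (_ * _).
have pull u1 u2 u3 u4 :
    contract (invmx (metric x)) (fun p q => cubicV x u1 u3 (dir p) * cubicV x u2 u4 (dir q))
    = contract (invmx (hessM x)) (fun P Q =>
      cubicV x u1 u3 (frame m rad x P) * cubicV x u2 u4 (frame m rad x Q)).
  rewrite -frame_invmx//; apply: contract_pull => p.
    rewrite {1}(dir_frame m_gt0 rad_gt0 xD p).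
    exact: (linear_form_sum _ _ (linear_cubicV3 _ _ _)).
  rewrite {1}(dir_frame m_gt0 rad_gt0 xD p).
  exact: (linear_form_sum _ _ (linear_cubicV3 _ _ _)).
have contractB N (K K' : 'I_4 -> 'I_4 -> R) :
    contract N (fun p q => K p q - K' p q) = contract N K - contract N K'.
  rewrite /contract -sumrB; apply: eq_bigr => p _; rewrite -sumrB.
  by apply: eq_bigr => q _; rewrite mulrBr.
rewrite contractB -!pull -contractB; apply: eq_contract => p q.
by rewrite !cubicf_dir.
Unshelve. all: by end_near.
Qed.

(** The norm can be computed in the frame, where the inverse Gram matrix converges; smallness of the
    tensor therefore follows from that of its frame components. *)
Lemma small_o1_frame (s : tensor4_field)
    (V : 'rV[R]_4 -> 'rV[R]_4 -> 'rV[R]_4 -> 'rV[R]_4 -> 'rV[R]_4 -> R) :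
  (forall x v w z, linear_form (fun u => V x u v w z)) ->
  (forall x u w z, linear_form (fun v => V x u v w z)) ->
  (forall x u v z, linear_form (fun w => V x u v w z)) ->
  (forall x u v w, linear_form (fun z => V x u v w z)) ->
  (forall x, chart_dom x -> (\forall y \near x, metric y \in unitmx) ->
    forall a b c d, s x a b c d = V x (dir a) (dir b) (dir c) (dir d)) ->
  (forall A B G D, V x (frame m rad x A) (frame m rad x B) (frame m rad x G)
    (frame m rad x D) @[x --> spinning] --> (0 : R)) ->
  small_o1 m rad e s.
Proof.
move=> l1 l2 l3 l4 sV V0.
pose sF x A B G D :=
  V x (frame m rad x A) (frame m rad x B) (frame m rad x G) (frame m rad x D).
have hL i j : hessM x i j @[x --> spinning] --> (\matrix_(A, B) hessL A B : 'M[R]_4) i j.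
  by rewrite mxE; under eq_fun do rewrite mxE; exact: cvg_hessF.
have [Lu _] := mulmx1_unit (@hessL_mul R).
have n0 : sqnorm4 (invmx (hessM x)) (sF x) @[x --> spinning] --> (0 : R).
  exact: cvg_sqnorm4 (cvg_invmx _ Lu hL) V0.
have r0 : Num.sqrt (sqnorm4 (invmx (hessM x)) (sF x)) @[x --> spinning] --> (0 : R).
  have sc : Num.sqrt y @[y --> (0 : R)] --> (0 : R).
    by have := @sqrt_continuous R 0; rewrite /continuous_at sqrtr0.
  exact: cvg_comp n0 sc.
move=> eps eps0.
have [M1 HM1] := near_metric_unit.
have /cvgrPdist_lt/(_ eps eps0) [M2 HM2] := r0.
(* The entry 0 forces positive spin, hence r <> 0 and a point of [chart_dom]. *)
exists (Num.max 0 (Num.max M1 M2)) => x b0; rewrite spinE// !gt_max => /and3P[s0 sM1 sM2].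
have xD : chart_dom x.
  by rewrite /chart_dom b0 /=; move: s0; rewrite /spin pmulr_lgt0 ?invr_gt0.
have gu := HM1 x xD sM1; have gxu := nbhs_singleton gu.
rewrite tensor4_normE.
have -> : s x = pull4 (coframe m rad x) (sF x).
  apply/funext => a; apply/funext => b; apply/funext => c; apply/funext => d.
  by rewrite sV// (pull4_multilinear m_gt0 rad_gt0 xD).
rewrite sqnorm4_pull frame_invmx//.
have := HM2 x xD sM2; rewrite /= sub0r normrN ger0_norm ?sqrtr_ge0//.
Qed.

Lemma linear_riemannV x :
  [/\ (forall v w z, linear_form (fun u => riemannV x u v w z)),
      (forall u w z, linear_form (fun v => riemannV x u v w z)),
      (forall u v z, linear_form (fun w => riemannV x u v w z)) &
      (forall u v w, linear_form (fun z => riemannV x u v w z))].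
Proof.
have key (K : 'rV[R]_4 -> 'I_4 -> 'I_4 -> R) :
    (forall P Q, linear_form (fun u => K u P Q)) ->
    linear_form (fun u => - 4^-1 * contract (invmx (hessM x)) (K u)).
  by move=> lK; exact: linear_formZ (linear_form_contract _ lK).
pose fr := frame m rad x.
pose K u1 u2 u3 u4 P Q := cubicV x u1 u3 (fr P) * cubicV x u2 u4 (fr Q)
    - cubicV x u1 u4 (fr P) * cubicV x u2 u3 (fr Q).
split=> [v w z|u w z|u v z|u v w].
- apply: (key (fun u => K u v w z)) => P Q.
  by apply: linear_formB; exact/linear_formZr/linear_cubicV1.
- apply: (key (fun v => K u v w z)) => P Q.
  by apply: linear_formB; exact/linear_formZ/linear_cubicV1.
- apply: (key (fun w => K u v w z)) => P Q; apply: linear_formB.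
    exact/linear_formZr/linear_cubicV2.
  exact/linear_formZ/linear_cubicV2.
- apply: (key (fun z => K u v w z)) => P Q; apply: linear_formB.
    exact/linear_formZ/linear_cubicV2.
  exact/linear_formZr/linear_cubicV2.
Qed.

Lemma linear_half_knV h :
  (forall w, linear_form (fun u => h u w)) -> (forall w, linear_form (fun u => h w u)) ->
  [/\ (forall v w z, linear_form (fun u => half_knV h u v w z)),
      (forall u w z, linear_form (fun v => half_knV h u v w z)),
      (forall u v z, linear_form (fun w => half_knV h u v w z)) &
      (forall u v w, linear_form (fun z => half_knV h u v w z))].
Proof.
move=> h1 h2; split=> [v w z|u w z|u v z|u v w].
- exact: linear_formB (linear_formZr (h v z) (h1 w)) (linear_formZr (h v w) (h1 z)).
- exact: linear_formB (linear_formZ (h u w) (h1 z)) (linear_formZ (h u z) (h1 w)).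
- exact: linear_formB (linear_formZr (h v z) (h2 u)) (linear_formZ (h u z) (h2 v)).
- exact: linear_formB (linear_formZ (h u w) (h2 v)) (linear_formZr (h v w) (h2 u)).
Qed.

Lemma cvg_riemannV A B G D :
  riemannV x (frame m rad x A) (frame m rad x B) (frame m rad x G)
    (frame m rad x D) @[x --> spinning] -->
  (- 12^-1 * (hessL A G * hessL B D - hessL A D * hessL B G) : R).
Proof.
have hL i j : hessM x i j @[x --> spinning] --> (\matrix_(A, B) hessL A B : 'M[R]_4) i j.
  by rewrite mxE; under eq_fun do rewrite mxE; exact: cvg_hessF.
have [Lu _] := mulmx1_unit (@hessL_mul R).
have iL := cvg_invmx _ Lu hL.
have -> : - 12^-1 * (hessL A G * hessL B D - hessL A D * hessL B G) =
  - 4^-1 * contract (invmx (\matrix_(A, B) hessL A B))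
    (fun P Q => cubicL A G P * cubicL B D Q - cubicL A D P * cubicL B G Q) :> R.
  by rewrite invmx_hessL contract_cubicL; field.
apply: (@cvg_trans _ ((fun x => - 4^-1 * contract (invmx (hessM x)) (fun P Q =>
    cubicF m rad x A G P * cubicF m rad x B D Q
    - cubicF m rad x A D P * cubicF m rad x B G Q)) x @[x --> spinning])).
  apply: near_eq_cvg; exists 0 => x xD _; rewrite /riemannV; congr (_ * _).
  by apply: eq_contract => P Q; rewrite /cubicV !cubic_frame.
apply: cvgM; first exact: cvg_cst.
apply: cvg_bigsum => P; apply: cvg_bigsum => Q; apply: cvgM; first exact: iL.
by apply: cvgB; apply: cvgM; exact: cvg_cubicF.
Qed.

(** Common form of both claims: the comparison tensor is - 1/12 times half the Kulkarni-Nomizu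
    square of a bilinear form h, and h only has to approach [hessL] in the frame. For the explicit
    tensor h is the limit metric, for the second claim it is g itself. *)
Lemma small_o1_curvature (s : tensor4_field) (h : 'rV[R]_4 -> 'rV[R]_4 -> 'rV[R]_4 -> R) :
  (forall x w, linear_form (fun u => h x u w)) ->
  (forall x w, linear_form (fun u => h x w u)) ->
  (forall x, chart_dom x -> forall a b c d,
    s x a b c d = - 12^-1 * half_knV (h x) (dir a) (dir b) (dir c) (dir d)) ->
  (forall A B,
    h x (frame m rad x A) (frame m rad x B) @[x --> spinning] --> (hessL A B : R)) ->
  small_o1 m rad e (fun x a b c d => riemann metric x a b c d - s x a b c d).
Proof.
move=> h1 h2 sE hL.
pose V x u1 u2 u3 u4 := riemannV x u1 u2 u3 u4 - - 12^-1 * half_knV (h x) u1 u2 u3 u4.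
apply: (@small_o1_frame _ V).
- move=> x v w z; have [l _ _ _] := linear_riemannV x.
  have [l' _ _ _] := linear_half_knV (h1 x) (h2 x).
  exact: linear_formB (l _ _ _) (linear_formZ _ (l' _ _ _)).
- move=> x v w z; have [_ l _ _] := linear_riemannV x.
  have [_ l' _ _] := linear_half_knV (h1 x) (h2 x).
  exact: linear_formB (l _ _ _) (linear_formZ _ (l' _ _ _)).
- move=> x v w z; have [_ _ l _] := linear_riemannV x.
  have [_ _ l' _] := linear_half_knV (h1 x) (h2 x).
  exact: linear_formB (l _ _ _) (linear_formZ _ (l' _ _ _)).
- move=> x v w z; have [_ _ _ l] := linear_riemannV x.
  have [_ _ _ l'] := linear_half_knV (h1 x) (h2 x).
  exact: linear_formB (l _ _ _) (linear_formZ _ (l' _ _ _)).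
- by move=> x xD gu a b c d; rewrite riemann_dir// sE.
move=> A B G D.
rewrite -(subrr (- 12^-1 * (hessL A G * hessL B D - hessL A D * hessL B G) : R)).
apply: cvgB; first exact: cvg_riemannV.
apply: cvgM; first exact: cvg_cst.
by apply: cvgB; apply: cvgM; exact: hL.
Qed.

End CurvatureInFrame.

(** * The explicit leading tensor *)

Section LeadingTensor.
Context {R : realType} (m rad : R) (e : 'I_3 -> 'M[R]_3).
Hypotheses (m_gt0 : 0 < m) (rad_gt0 : 0 < rad) (e_basis : so3_orthonormal_basis e).
Local Open Scope classical_set_scope.
Local Notation dir a := (delta_mx 0 a : 'rV[R]_4).
Implicit Types (x u v w : 'rV[R]_4).

(** The coframe form dual to the i-th rescaled field; it equals - beta * fscale * domega_i. *)
Definition xiv x (i : 'I_3) u : R :=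
  fscale m rad x * (u 0 (lift ord0 i) - x 0 (lift ord0 i) * etav x u).

(* The limiting metric [m rad^2 beta domega^2 + 3 beta du^2]. *)
Definition leadV x u v : R := 3 * etav x u * etav x v + \sum_i xiv x i u * xiv x i v.

Lemma linear_xiv x i : linear_form (xiv x i).
Proof. by move=> k u v; rewrite /xiv linear_etav !mxE; ring. Qed.

Lemma leadVC x u v : leadV x u v = leadV x v u.
Proof.
rewrite /leadV mulrAC; congr (_ + _).
by apply: eq_bigr => i _; rewrite mulrC.
Qed.

Lemma linear_leadV1 x w : linear_form (fun u => leadV x u w).
Proof.
have l1 : linear_form (fun u => 3 * etav x u * etav x w).
  by move=> k u v; rewrite linear_etav; ring.
have l2 : linear_form (fun u => \sum_i xiv x i u * xiv x i w).
  apply: linear_form_bigsum => i; exact/linear_formZr/linear_xiv.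
exact: linear_formD l1 l2.
Qed.

Lemma linear_leadV2 x w : linear_form (fun u => leadV x w u).
Proof. by move=> k u v; rewrite !(leadVC x w) linear_leadV1. Qed.

(** The frame components equal their limit exactly, at every point of [chart_dom]. *)
Lemma leadV_frame x A B : chart_dom x ->
  leadV x (frame m rad x A) (frame m rad x B) = hessL A B.
Proof.
move=> xD; have k0 : fscale m rad x != 0 by rewrite gt_eqF ?fscale_gt0.
rewrite /leadV !etav_frame// /hessL; congr (_ + _).
have xiE i C : xiv x i (frame m rad x C) = (lift ord0 i == C)%:R.
  rewrite /xiv etav_frame// /frame /etaF; case: (eqVneq C ord0) => [->|C0] /=.
    by rewrite mulr1 subrr mulr0.
  by rewrite !mxE eqxx /= mulr0 subr0 mulVKf.
under eq_bigr do rewrite !xiE.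
rewrite /PF; case: (unliftP ord0 A) => [j ->|->] /=; last first.
  by rewrite andbF big1// => i _; rewrite mul0r.
rewrite (bigD1 j)//= eqxx mul1r big1 ?addr0 ?andbT// => i ij.
by rewrite (inj_eq lift_inj) (negbTE ij) mul0r.
Qed.

Lemma differential_u_of x a : chart_dom x ->
  differential u_of x a = - (Num.sqrt (beta_of x))^-1 * eta a x.
Proof.
move=> xD; move/andP: (xD) => [b0 _].
have s0 : Num.sqrt (beta_of x) != 0 by rewrite gt_eqF ?sqrtr_gt0.
have bn0 : beta_of x != 0 by rewrite gt_eqF.
rewrite /differential /partial.
suff: is_derive x (dir a) u_of (- (Num.sqrt (beta_of x))^-1 * eta a x).
  by move=> ?; exact: derive_val.
apply: (partial_chart xD (g := fun y => 2 * (Num.sqrt (y 0 ord0))^-1)).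
  by move=> y /andP[yb _]; rewrite /u_of powRN powR12_sqrt// ltW.
have d1 := is_derive_comp1 (is_derive_coord x a ord0) (is_derive1_sqrt b0).
have d2 := is_derive_inv (f := fun y : 'rV[R]_4 => Num.sqrt (y 0 ord0)) s0 d1.
have d3 := is_derive_mul (is_derive_cst_fun 2 x (dir a)) d2.
apply: is_derive_eq; rewrite /GRing.scale /= /eta.
rewrite -/(beta_of x) sqr_sqrtr ?(ltW b0)//.
by field; rewrite s0 bn0.
Qed.

Lemma differential_omega_coord x i a : chart_dom x ->
  differential (omega_coord i) x a =
  - (beta_of x * fscale m rad x)^-1 * xiv x i (dir a).
Proof.
move=> xD; move/andP: (xD) => [b0 _].
have k0 : fscale m rad x != 0 by rewrite gt_eqF ?fscale_gt0.
have bn0 : beta_of x != 0 by rewrite gt_eqF.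
rewrite /differential /partial.
suff: is_derive x (dir a) (omega_coord i)
    (- (beta_of x * fscale m rad x)^-1 * xiv x i (dir a)).
  by move=> ?; exact: derive_val.
have d1 := is_derive_opp (is_derive_coord x a (lift ord0 i)).
have d2 := is_derive_inv bn0 (is_derive_coord x a ord0).
apply: (is_derive_eq (is_derive_mul d1 d2)).
rewrite /xiv etav_dir// /eta mxE eqxx /= -/(beta_of x) [lift ord0 i == a]eq_sym.
by field; rewrite k0 bn0.
Qed.

(** In the Kulkarni-Nomizu square of 3 eta^2 + sum_i xi_i^2 the terms in eta alone cancel by
    antisymmetry. The terms in xi alone give the domega part, and the mixed terms, with 3/12 = 1/4,
    give the part containing du. *)
Lemma leading_riemannE x a b c d : chart_dom x ->
  leading_riemann (m * rad ^+ 2) x a b c d =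
  - 12^-1 * half_knV (leadV x) (dir a) (dir b) (dir c) (dir d).
Proof.
move=> xD; move/andP: (xD) => [b0 _].
have k0 : fscale m rad x != 0 by rewrite gt_eqF ?fscale_gt0.
have bn0 : beta_of x != 0 by rewrite gt_eqF.
set k := fscale m rad x in k0; set B := beta_of x in bn0 b0.
have s0 : Num.sqrt B != 0 by rewrite gt_eqF ?sqrtr_gt0.
have s2 : (Num.sqrt B)^-1 ^+ 2 = B^-1 by rewrite exprVn sqr_sqrtr ?ltW.
(* Eliminating m R^2 in favour of the frame scale makes the powers of beta and k cancel. *)
have IE : m * rad ^+ 2 = k ^+ 2 * B.
  by rewrite /k fscale_sqr// /half_inertia -/B; field.
pose X i a := xiv x i (dir a); pose p a b := \sum_i X i a * X i b.
pose E a := eta a x.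
have wE i a' : differential (omega_coord i) x a' = - (B * k)^-1 * X i a'.
  exact: differential_omega_coord.
have uE a' : differential u_of x a' = - (Num.sqrt B)^-1 * E a'.
  exact: differential_u_of.
have quad (f1 f2 g1 g2 : 'I_3 -> R) :
    (\sum_i f1 i * f2 i) * (\sum_j g1 j * g2 j) =
    \sum_i \sum_j f1 i * f2 i * (g1 j * g2 j).
  by rewrite mulr_suml; apply: eq_bigr => i _; rewrite mulr_sumr.
rewrite /leading_riemann /tensor_prod4 -/B.
have -> : \sum_(i < 3) \sum_(j < 3)
    (differential (omega_coord i) x a * differential (omega_coord j) x b *
       differential (omega_coord i) x c * differential (omega_coord j) x d
     - differential (omega_coord j) x a * differential (omega_coord i) x b *
       differential (omega_coord i) x c * differential (omega_coord j) x d) =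
    (B * k)^-1 ^+ 4 * (p a c * p b d - p a d * p b c).
  rewrite [p a d * _]mulrC /p !quad -sumrB mulr_sumr.
  apply: eq_bigr => i _; rewrite -sumrB mulr_sumr; apply: eq_bigr => j _.
  by rewrite !wE; ring.
have -> : \sum_(i < 3)
    (differential (omega_coord i) x a * differential u_of x b *
       differential u_of x c * differential (omega_coord i) x d
     - differential u_of x a * differential (omega_coord i) x b *
       differential u_of x c * differential (omega_coord i) x d
     + differential u_of x a * differential (omega_coord i) x b *
       differential (omega_coord i) x c * differential u_of x d
     - differential (omega_coord i) x a * differential u_of x b *
       differential (omega_coord i) x c * differential u_of x d) =
    (B * k)^-1 ^+ 2 * (Num.sqrt B)^-1 ^+ 2 *
    (p a d * E b * E c - E a * E c * p b d + p b c * E a * E d - p a c * E b * E d).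
  rewrite /p !mulr_suml mulr_sumr -sumrB -big_split -sumrB mulr_sumr /=.
  by apply: eq_bigr => i _; rewrite !wE !uE; ring.
rewrite s2 IE /half_knV /leadV !etav_dir//.
have pE a' b' : \sum_i xiv x i (dir a') * xiv x i (dir b') = p a' b' by [].
rewrite (pE a c) (pE b d) (pE a d) (pE b c) -/(E a) -/(E b) -/(E c) -/(E d); field.
by rewrite k0 bn0.
Qed.

End LeadingTensor.

Theorem theorem4p25 (R : realType) (m rad : R) (hm : 0 < m) (hrad : 0 < rad)
    (e : 'I_3 -> 'M[R]_3) (he : so3_orthonormal_basis e) :
  let g := gas_metric m rad e in
  small_o1 m rad e (fun x a b c d =>
    riemann g x a b c d - leading_riemann (m * rad ^+ 2) x a b c d)
  /\
  small_o1 m rad e (fun x a b c d =>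
    riemann g x a b c d - (- 12^-1 * half_kulkarni_nomizu g x a b c d)).
Proof.
move=> g; split.
  apply: (small_o1_curvature hm hrad he (h := leadV m rad)).
  - exact: linear_leadV1.
  - exact: linear_leadV2.
  - by move=> x xD a b c d; exact: leading_riemannE.
  - move=> A B; apply: (@cvg_trans _ ((hessL A B : R) @[x --> @spinning R])%classic).
      apply: near_eq_cvg; exists 0 => x xD _.
      by rewrite leadV_frame.
    exact: cvg_cst.
apply: (small_o1_curvature hm hrad he (h := hessV m rad)).
- exact: linear_hessV1.
- exact: linear_hessV2.
- by move=> x xD a b c d; rewrite /half_kulkarni_nomizu /g !(metric_dir hm hrad he).
- move=> A B; apply: (@cvg_trans _ (hessF m rad x A B @[x --> @spinning R])%classic).
    apply: near_eq_cvg; exists 0 => x xD _.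
    by rewrite /hessV hess_frame.
  exact: cvg_hessF.
Qed.
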